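(* Let $w_n$ be the number of weak-ordering chains in $\mathcal{WOC}(n)$ subject to the stopping condition $x_{i_1}<x_{i_2}<x_{i_3}$ with $i_1<i_2<i_3$. Then \[ w_n=\sum_{d=0}^{n-1}2^d e_{n,d}+\sum_{j=3}^{n}\sum_{d=0}^{j-3}2^d g_{j,d}. \] The sequence starts $1,3,13,69,401,2433,15121,95441,\dots$, and $W(x)=\sum_{n\ge1}w_nx^n$ satisfies \[ W(x)=\frac{x+x\sqrt{1-8x+8x^2}}{2(1-x)\sqrt{1-8x+8x^2}}. \]
   Context: A weak-ordering chain on $x_1,\dots,x_m$ is an expression $x_{i_1}\,\mathrm{op}\,x_{i_2}\,\mathrm{op}\cdots\mathrm{op}\,x_{i_m}$, where $(i_1,\dots,i_m)$ is an ordering of $[m]$ and each $\mathrm{op}$ is $<$ or $=$; expressions defining the same ordered set partition of $[m]$ are identified. $\mathcal{WOC}(m)$ is the set of these chains. Each chain in $\mathcal{WOC}(m)$, $m\ge 2$, arises uniquely from its restriction to $x_1,\dots,x_{m-1}$ by inserting $x_m$; this gives a rooted tree with root $x_1$ whose level-$m$ nodes are the elements of $\mathcal{WOC}(m)$. The restricted generating tree of order $n$ for a stopping condition is the part of this tree up to level $n$ in which any node containing the stopping condition has no descendants; ''the number of weak-ordering chains in $\mathcal{WOC}(n)$ subject to the stopping condition'' is the number of leaves of this tree (nodes at level $n$ plus nodes containing the condition), equivalently the number of chains in $\mathcal{WOC}(n)$ avoiding the condition plus, for each $j\le n$, the number of chains in $\mathcal{WOC}(j)$ containing the condition whose restriction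 to $x_1,\dots,x_{j-1}$ avoids it. Here a chain contains the stopping condition if there are indices $i_1<i_2<i_3$ with $x_{i_1}<x_{i_2}<x_{i_3}$ in the chain. $e_{n,d}$ is the number of $123$-avoiding permutations of $[n]$ with exactly $d$ descents (a descent of $\sigma$ is an $i$ with $\sigma(i)>\sigma(i+1)$). $g_{j,d}=|\mathcal{G}^d_j(123)|$, where for $j>3$, $1\le d\le j-3$, $\mathcal{G}^d_j(123)$ is the set of permutations $\sigma$ of $[j]$ that contain the pattern $123$, have exactly $d$ descents, and such that the permutation $\sigma'$ obtained by deleting $j$ avoids $123$; $\mathcal{G}^0_3(123)=\{123\}$, and $g_{j,d}=0$ otherwise. *)

(* Defs.v *)
From HB Require Import structures.
From mathcomp Require Import all_boot all_order all_fingroup all_algebra.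
From mathcomp Require Import boolp.

Set Implicit Arguments.
Unset Strict Implicit.
Unset Printing Implicit Defensive.

Import GRing.Theory.

(* The set [m] = {1, ..., m} is 'I_m = {0, ..., m-1}.  A chain is the ordered
   set partition it defines: the list of its blocks of equal variables, in
   increasing order.  For instance x_2 < x_1 = x_3 is [:: {1}; {0, 2}].  The
   blocks are nonempty and disjoint, so there are at most m of them, and the
   bound of m.-bseq serves only to make the type finite. *)
Definition WOC (m : nat) : {set m.-bseq {set 'I_m}} :=
  [set c : m.-bseq {set 'I_m} | uniq c & partition [set:: c] [set: 'I_m]].

Definition block_index (m : nat) (c : seq {set 'I_m}) (i : 'I_m) : nat :=
  find (fun B : {set 'I_m} => i \in B) c.

Definition chain_lt (m : nat) (c : seq {set 'I_m}) (i j : 'I_m) : bool :=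
  block_index c i < block_index c j.

Definition stops (m : nat) (c : seq {set 'I_m}) : bool :=
  [exists i1 : 'I_m, exists i2 : 'I_m, exists i3 : 'I_m,
     [&& i1 < i2, i2 < i3, chain_lt c i1 i2 & chain_lt c i2 i3]].

(* The restriction of a chain on x_1, ..., x_{m+1} to x_1, ..., x_m: a block
   that contained only x_{m+1} disappears. *)
Definition parent (m : nat) (c : seq {set 'I_m.+1}) : seq {set 'I_m} :=
  [seq B <- [seq [set i : 'I_m | widen_ord (leqnSn m) i \in B]
                  | B : {set 'I_m.+1} <- c]
     | B != set0].

(* A chain is a node of the restricted generating tree when none of its proper
   ancestors contains the stopping condition.  The empty chain at level 0 never
   contains it, so the root, at level 1, is a node. *)
Fixpoint is_node (m : nat) : seq {set 'I_m} -> bool :=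
  match m return seq {set 'I_m} -> bool with
  | 0 => fun _ => true
  | m'.+1 => fun c => is_node (parent c) && ~~ stops (parent c)
  end.

Definition leaves (n j : nat) : {set j.-bseq {set 'I_j}} :=
  [set c in WOC j | is_node c & (j == n) || stops c].

Definition w (n : nat) : nat := \sum_(1 <= j < n.+1) #|leaves n j|.

(* One-line notation, with values 0, ..., n-1. *)
Definition word (n : nat) (s : 'S_n) : seq nat := [seq val (s i) | i <- enum 'I_n].

Definition contains123 (u : seq nat) : bool :=
  [exists i1 : 'I_(size u), exists i2 : 'I_(size u), exists i3 : 'I_(size u),
     [&& i1 < i2, i2 < i3,
         nth 0 u i1 < nth 0 u i2 & nth 0 u i2 < nth 0 u i3]].

Definition descents (u : seq nat) : nat :=
  count (fun i => nth 0 u i.+1 < nth 0 u i) (iota 0 (size u).-1).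

Definition e (n d : nat) : nat :=
  #|[set s : 'S_n | ~~ contains123 (word s) & descents (word s) == d]|.

(* The largest value, j in the mathematical convention, is j.-1 here; for
   j = 3 the permutation 123 is the identity. *)
Definition G (d j : nat) : {set 'S_j} :=
  if [&& 3 < j, 1 <= d & d <= j - 3] then
    [set s : 'S_j | [&& contains123 (word s), descents (word s) == d
                      & ~~ contains123 (rem j.-1 (word s))]]
  else if (j == 3) && (d == 0) then [set 1%g]
  else set0.

Definition g (j d : nat) : nat := #|G d j|.

Local Open Scope ring_scope.

Record fps (F : fieldType) := FPS { fcoef : nat -> F }.

HB.instance Definition _ (F : fieldType) := gen_eqMixin (fps F).
HB.instance Definition _ (F : fieldType) := gen_choiceMixin (fps F).

Section FPSRing.
Variable F : fieldType.
Implicit Types f h k : fps F.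

Lemma fpsP f h : fcoef f =1 fcoef h -> f = h.
Proof. by case: f h => [f] [h] /= /funext ->. Qed.

Definition fps_zero : fps F := FPS (fun _ => 0).
Definition fps_one : fps F := FPS (fun n => (n == 0%N)%:R).
Definition fps_opp f : fps F := FPS (fun n => - fcoef f n).
Definition fps_add f h : fps F := FPS (fun n => fcoef f n + fcoef h n).
Definition fps_mul f h : fps F :=
  FPS (fun n => \sum_(i < n.+1) fcoef f i * fcoef h (n - i)%N).

Fact fps_addA : associative fps_add.
Proof. by move=> f h k; apply: fpsP => n /=; rewrite addrA. Qed.
Fact fps_addC : commutative fps_add.
Proof. by move=> f h; apply: fpsP => n /=; rewrite addrC. Qed.
Fact fps_add0 : left_id fps_zero fps_add.
Proof. by move=> f; apply: fpsP => n /=; rewrite add0r. Qed.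
Fact fps_addN : left_inverse fps_zero fps_opp fps_add.
Proof. by move=> f; apply: fpsP => n /=; rewrite addNr. Qed.

HB.instance Definition _ := GRing.isZmodule.Build (fps F)
  fps_addA fps_addC fps_add0 fps_addN.

Let trunc m f : {poly F} := \poly_(i < m) fcoef f i.

Let coef_trunc m f i : (i < m)%N -> (trunc m f)`_i = fcoef f i.
Proof. by move=> lt_im; rewrite coef_poly lt_im. Qed.

Let fps_mulE m f h n : (n < m)%N ->
  fcoef (fps_mul f h) n = (trunc m f * trunc m h)`_n.
Proof.
move=> lt_nm; rewrite coefM /=; apply: eq_bigr => i _.
have le_in : (i <= n)%N by rewrite -ltnS.
rewrite !coef_trunc //; first exact: leq_ltn_trans (leq_subr _ _) lt_nm.
exact: leq_ltn_trans lt_nm.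
Qed.

Fact fps_mulC : commutative fps_mul.
Proof.
move=> f h; apply: fpsP => n.
by rewrite !(@fps_mulE n.+1) // mulrC.
Qed.

Fact fps_mulA : associative fps_mul.
Proof.
move=> f h k; apply: fpsP => n.
transitivity ((trunc n.+1 f * (trunc n.+1 h * trunc n.+1 k))`_n).
  rewrite coefM /=; apply: eq_bigr => i _.
  rewrite coef_trunc //; congr (_ * _).
  by apply: (@fps_mulE n.+1); rewrite ltnS leq_subr.
rewrite mulrA coefM /=; apply: eq_bigr => i _.
rewrite coef_trunc ?ltnS ?leq_subr //; congr (_ * _).
by rewrite -(@fps_mulE n.+1).
Qed.

Fact fps_mul1 : left_id fps_one fps_mul.
Proof.
move=> f; apply: fpsP => n /=.
by rewrite big_ord_recl subn0 mul1r big1 ?addr0 // => i _; rewrite mul0r.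
Qed.

Fact fps_mulDl : left_distributive fps_mul +%R.
Proof.
move=> f h k; apply: fpsP => n /=; rewrite -big_split /=.
by apply: eq_bigr => i _; rewrite mulrDl.
Qed.

Fact fps_one_neq0 : fps_one != 0.
Proof.
apply/eqP => /(congr1 (fun f => fcoef f 0)) /= /eqP.
by rewrite oner_eq0.
Qed.

HB.instance Definition _ := GRing.Zmodule_isComNzRing.Build (fps F)
  fps_mulA fps_mulC fps_mul1 fps_mulDl fps_one_neq0.

(* Course-of-values recursion: step computes the n-th coefficient from the list
   of the n previous ones. *)
Fixpoint fps_prefix (step : seq F -> F) (n : nat) : seq F :=
  if n is n'.+1 then
    let s := fps_prefix step n' in rcons s (step s)
  else [::].

Definition fps_rec (step : seq F -> F) : fps F :=
  FPS (fun n => step (fps_prefix step n)).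

Lemma fps_prefixE step n :
  fps_prefix step n = mkseq (fcoef (fps_rec step)) n.
Proof.
by elim: n => //= n IHn; rewrite {1}IHn -addn1 /mkseq iotaD map_cat cats1.
Qed.

Definition fps_inv_step f (s : seq F) : F :=
  if s is [::] then (fcoef f 0)^-1
  else - (fcoef f 0)^-1 * \sum_(i < size s) s`_i * fcoef f (size s - i)%N.

Definition fps_unit : {pred fps F} := fun f => fcoef f 0 != 0.

(* As for every ring with units in the library, a non-unit is its own
   "inverse". *)
Definition fps_inv f : fps F :=
  if f \in fps_unit then fps_rec (fps_inv_step f) else f.

Fact fps_mulVx : {in fps_unit, left_inverse 1 fps_inv *%R}.
Proof.
move=> f uf; apply: fpsP => n; rewrite /fps_inv uf.
have {}uf : fcoef f 0 != 0 := uf.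
rewrite /GRing.mul /= big_ord_recr /= subnn fps_prefixE.
case: n => [|n]; first by rewrite big_ord0 add0r /= mulVf.
rewrite /fps_inv_step size_mkseq /=.
set S := \sum_(i < _) _ * _; set T := \sum_(i < _) _ * _.
have -> : T = S.
  by apply: eq_bigr => i _; rewrite (nth_mkseq 0) // fps_prefixE.
by rewrite mulrAC mulNr mulVf // mulN1r subrr.
Qed.

Fact fps_unitPl f h : h * f = 1 -> fps_unit f.
Proof.
move/(congr1 (fun u => fcoef u 0)); rewrite /= big_ord1 /fps_unit => hf1.
by apply: contra_eq_neq hf1 => ->; rewrite mulr0 eq_sym oner_eq0.
Qed.

Fact fps_inv_out : {in [predC fps_unit], fps_inv =1 id}.
Proof. by move=> f; rewrite inE /= /fps_inv => /negPf ->. Qed.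

HB.instance Definition _ := GRing.ComNzRing_hasMulInverse.Build (fps F)
  fps_mulVx fps_unitPl fps_inv_out.

Definition fpsX : fps F := FPS (fun n => (n == 1%N)%:R).

(* The square root with constant coefficient 1 of a series with constant
   coefficient 1, obtained from
     f_n = 2 s_n + \sum_(0 < i < n) s_i s_(n-i)   for n > 0. *)
Definition fps_sqrt_step f (s : seq F) : F :=
  if s is [::] then 1
  else (fcoef f (size s) - \sum_(1 <= i < size s) s`_i * s`_(size s - i)%N) / 2%:R.

Definition fps_sqrt f : fps F := fps_rec (fps_sqrt_step f).

Lemma fps_sqrt0 f : fcoef (fps_sqrt f) 0 = 1.
Proof. by []. Qed.

Lemma fps_sqrtK f : 2%:R != 0 :> F -> fcoef f 0 = 1 -> fps_sqrt f ^+ 2 = f.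
Proof.
move=> nz2 f0; apply: fpsP => -[|n]; rewrite expr2 {1}/GRing.mul.
  by rewrite /= big_ord1 /= mulr1 f0.
cbn [fps_mul fcoef GRing.mul]; rewrite [LHS]/=.
pose s := fcoef (fps_sqrt f).
rewrite -(big_mkord xpredT (fun i => s i * s (n.+1 - i)%N)).
rewrite big_nat_recr //= big_ltn // subnn subn0.
have s0 : s 0%N = 1 by [].
have -> : s n.+1 = (fcoef f n.+1
     - \sum_(1 <= i < n.+1) s i * s (n.+1 - i)%N) / 2%:R.
  rewrite {1}/s /fps_sqrt; cbn [fps_rec fcoef].
  have stepE u : size u = n.+1 -> fps_sqrt_step f u =
      (fcoef f (size u) - \sum_(1 <= i < size u) u`_i * u`_(size u - i)%N) / 2%:R.
    by case: u.
  rewrite fps_prefixE stepE size_mkseq //; congr ((_ - _) / _).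
  apply: eq_big_nat => i /andP[i0 lti].
  by rewrite !(nth_mkseq 0) // ltn_subrL i0.
rewrite s0 mul1r mulr1 addrAC -mulr2n -[_ / _ *+ 2]mulr_natr divfK //.
by rewrite subrK.
Qed.

End FPSRing.

Definition W : fps rat := FPS (fun n => if (n == 0)%N then 0 else (w n)%:R).

(* Main.v *)
(** A chain is a permutation word cut into strictly decreasing runs (its blocks),
    and it contains the stopping condition exactly when its word contains 123:
    each word u stands for 2^(descents u) chains.

    Inserting the largest letter in all positions of u shows that [w (n+1) - w n]
    is the sum of [2^d (2n - d)] over the 123-avoiders of length n, with d the
    number of descents.  Read from left to right, a 123-avoider takes either a
    new minimum or the largest letter still available.  This gives a Dyck path
    whose down steps are the letters and whose up steps bring letters above the
    current minimum; an ascent is a factor up-down-down.  Contracting s of these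
    factors to marked down steps shows that there are [Cat_(n-s) 'C(n-s, s)]
    avoiders with s marked ascents.  Expanding [2^d (2n - d)] over the sets of
    marked ascents turns [2 (w (n+1) - w n)] into the coefficient of x^n in
    [sum_m 'C(2m, m) (2 x (1 - x))^m = 1 / sqrt (1 - 8 x (1 - x))]. *)
From mathcomp Require Import fingroup perm.
Require Import Defs.
From Stdlib Require Import BinNat.
From mathcomp Require Import all_boot all_order all_algebra.
From mathcomp Require Import zify ring.

Set Implicit Arguments.
Unset Strict Implicit.
Unset Printing Implicit Defensive.

Import GRing.Theory.

(** * 123-avoiding words, ascents and descents *)

(** The default [x] of [head] makes the last letter count as no ascent; [descents_cons] and [cuts]
    use the same device. *)
Fixpoint ascents (u : seq nat) : nat :=
  if u is x :: v then (x < head x v) + ascents v else 0.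

Lemma descents_cons (x : nat) (v : seq nat) :
  descents (x :: v) = (head x v < x) + descents v.
Proof.
case: v => [|y v]; first by rewrite /descents /= ltnn.
rewrite /descents /= -[1]/(0 + 1)%N; congr (_ + _).
by rewrite (iotaDl 1 0) count_map; apply: eq_count.
Qed.

Lemma descents_ascents (u : seq nat) :
  uniq u -> descents u + ascents u = (size u).-1.
Proof.
elim: u => [|x [|y v] IHv] //=; first by rewrite descents_cons /= ltnn.
move=> /andP[]; rewrite inE negb_or => /andP[neq_xy _] /IHv {}IHv.
rewrite descents_cons /=.
have: (y < x) + (x < y) = 1 by case: ltngtP neq_xy.
by move: IHv => /=; lia.
Qed.

Lemma descents_ascents_perm (n : nat) (u : seq nat) :
  perm_eq u (iota 0 n) -> descents u + ascents u = n.-1.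
Proof.
move=> perm_u; rewrite descents_ascents; last by rewrite (perm_uniq perm_u) iota_uniq.
by rewrite (perm_size perm_u) size_iota.
Qed.

Lemma subseq_iota (s : seq nat) (m : nat) :
  sorted ltn s -> {in s, forall i, i < m} -> subseq s (iota 0 m).
Proof.
move=> s_sorted s_lt.
have -> : s = filter (mem s) (iota 0 m).
  apply: (irr_sorted_eq ltn_trans ltnn) => //.
    by apply: sorted_filter => //; [exact: ltn_trans | exact: iota_ltn_sorted].
  move=> i; rewrite mem_filter mem_iota /= add0n andb_idr //; exact: s_lt.
exact: filter_subseq.
Qed.

(** The subsequence form lends itself to induction on the word and to deleting letters. Both
    directions view [u] as the image of its list of positions. *)
Lemma contains123P (u : seq nat) :
  reflect (exists x y z, [/\ x < y, y < z & subseq [:: x; y; z] u])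
          (contains123 u).
Proof.
have uE : u = map (nth 0 u) (iota 0 (size u)) by rewrite map_nth_iota0 // take_size.
apply: (iffP existsP) => [[i /existsP[j /existsP[k]]] | [x [y [z []]]]].
  case/and4P=> lt_ij lt_jk lt_xy lt_yz.
  exists (nth 0 u i), (nth 0 u j), (nth 0 u k); split=> //.
  suff: subseq (map (nth 0 u) [:: val i; val j; val k]) (map (nth 0 u) (iota 0 (size u))).
    by rewrite -uE.
  apply/map_subseq/subseq_iota; first by rewrite /= lt_ij lt_jk.
  by move=> l; rewrite !inE => /or3P[] /eqP ->; apply: ltn_ord.
move=> lt_xy lt_yz; rewrite {1}uE => /subseqP[m _]; rewrite -map_mask.
have := mask_subseq m (iota 0 (size u)); move: (mask _ _) => [|i [|j [|k []]]] //.
move=> sub_ijk [xE yE zE].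
have := subseq_sorted ltn_trans sub_ijk (iota_ltn_sorted 0 _) => /= /and3P[lt_ij lt_jk _].
have lt_k : k < size u.
  by have := mem_subseq sub_ijk (_ : k \in _); rewrite !inE eqxx !orbT mem_iota => /(_ isT).
have lt_j := ltn_trans lt_jk lt_k; have lt_i := ltn_trans lt_ij lt_j.
exists (Ordinal lt_i); apply/existsP; exists (Ordinal lt_j).
apply/existsP; exists (Ordinal lt_k) => /=.
by rewrite lt_ij lt_jk -xE -yE -zE lt_xy.
Qed.

(** This form compares positions of given letters, as [chain_lt] does for given variables. *)
Lemma contains123_index (u : seq nat) : uniq u ->
  reflect (exists x y z, [/\ x < y, y < z, z \in u,
             index x u < index y u & index y u < index z u])
          (contains123 u).
Proof.
move=> uniq_u; apply: (iffP existsP) => [[i /existsP[j /existsP[k]]] | ].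
  case/and4P=> lt_ij lt_jk lt_xy lt_yz.
  exists (nth 0 u i), (nth 0 u j), (nth 0 u k).
  by rewrite mem_nth ?index_uniq.
case=> x [y [z [lt_xy lt_yz zu lt_ij lt_jk]]].
have lt_k : index z u < size u by rewrite index_mem.
have lt_j := ltn_trans lt_jk lt_k; have lt_i := ltn_trans lt_ij lt_j.
exists (Ordinal lt_i); apply/existsP; exists (Ordinal lt_j).
apply/existsP; exists (Ordinal lt_k) => /=.
by rewrite lt_ij lt_jk !nth_index -?index_mem ?lt_xy.
Qed.

Lemma contains123_subseq (u v : seq nat) :
  subseq u v -> contains123 u -> contains123 v.
Proof.
move=> uv /contains123P[x [y [z [lt_xy lt_yz sub]]]].
by apply/contains123P; exists x, y, z; split=> //; apply: subseq_trans uv.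
Qed.

Lemma contains123_cons (x : nat) (u : seq nat) : contains123 u -> contains123 (x :: u).
Proof. by apply: contains123_subseq; apply: subseq_cons. Qed.

(** A letter above all later ones cannot start an occurrence of 123. *)
Lemma contains123_cons_max (x : nat) (u : seq nat) :
  {in u, forall y, y < x} -> contains123 (x :: u) = contains123 u.
Proof.
move=> max_x; apply/idP/idP; last exact: contains123_cons.
case/contains123P=> a [b [c [lt_ab lt_bc /=]]].
case: eqP => [ax | _ sub]; last by apply/contains123P; exists a, b, c.
move/mem_subseq/(_ b); rewrite inE eqxx => /(_ isT) /max_x.
by rewrite -ax ltnNge ltnW.
Qed.

(** An occurrence starting at [y] cannot continue with the smaller [x], so it can start at [x]
    instead. *)
Lemma contains123_cons2_lt (y x : nat) (u : seq nat) :
  x < y -> contains123 (y :: x :: u) = contains123 (x :: u).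
Proof.
move=> lt_xy; apply/idP/idP; last exact: contains123_cons.
case/contains123P=> a [b [c [lt_ab lt_bc /=]]].
case: eqP => [ay | _ sub]; last first.
  by apply/contains123P; exists a, b, c.
case: eqP => [bx | _ sub].
  by move: lt_ab lt_xy; rewrite ay bx => /ltnW; rewrite leqNgt => /negP.
apply/contains123P; exists x, b, c; split=> //=; last by rewrite eqxx.
by apply: ltn_trans lt_ab; rewrite ay.
Qed.

(** The letter [y] exceeds all later ones, so it could only end an occurrence, but a single letter
    precedes it. *)
Lemma contains123_cons2_max (x y : nat) (u : seq nat) :
  {in u, forall z, z < y} -> contains123 (x :: y :: u) = contains123 (x :: u).
Proof.
move=> max_y; apply/idP/idP; last first.
  by apply: contains123_subseq; rewrite /= eqxx; apply: subseq_cons.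
case/contains123P=> a [b [c [lt_ab lt_bc /=]]].
have no_c v : subseq [:: c] v -> c \in v by rewrite sub1seq.
case: eqP => [ax | _].
  case: eqP => [yb | _ sub]; first by move/no_c/max_y; rewrite -yb ltnNge ltnW.
  by apply/contains123P; exists a, b, c; split=> //=; rewrite ax eqxx.
case: eqP => [ya | _ sub].
  move/mem_subseq/(_ b); rewrite inE eqxx => /(_ isT) /max_y.
  by rewrite -ya ltnNge ltnW.
by apply/contains123_cons/contains123P; exists a, b, c.
Qed.

(** The word must rise somewhere between [x] and [y], and again between [y] and [z]. *)
Lemma contains123_ascents (u : seq nat) : contains123 u -> 1 < ascents u.
Proof.
have asc1 x (v : seq nat) : has (ltn x) v -> 0 < ascents (x :: v).
  elim: v x => [|y v IHv] x //=; case: ltnP => //= le_yx.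
  case/hasP=> z zv lt_xz; have /= := IHv y; rewrite add0n; apply.
  by apply/hasP; exists z => //; apply: leq_ltn_trans lt_xz.
have asc1' y z (v : seq nat) : y < z -> subseq [:: y; z] v -> 0 < ascents v.
  elim: v => // s v IHv lt_yz /=; case: eqP => [<- | _ /(IHv lt_yz)]; last by lia.
  by rewrite sub1seq => zv; apply: (asc1 y); apply/hasP; exists z.
have asc2 x y z (v : seq nat) : x < y -> y < z -> subseq [:: y; z] v ->
    1 < ascents (x :: v).
  elim: v x => [|t v IHv] x // lt_xy lt_yz /=; case: eqP => [<- | _] sub.
    rewrite lt_xy; suff: 0 < ascents (y :: v) by [].
    by apply: asc1; apply/hasP; exists z => //; rewrite -sub1seq.
  have [lt_ty | le_yt] := ltnP t y.
    by have /= := IHv t lt_ty lt_yz sub; lia.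
  have := asc1' y z v lt_yz sub; have := leq_trans lt_xy le_yt; lia.
case/contains123P=> x [y [z [lt_xy lt_yz]]].
elim: u => [|t u IHu] //=; case: eqP => [<- | _ /IHu]; last by lia.
exact: (asc2 x y z).
Qed.

(** * Chains as words cut into decreasing runs *)

Lemma gtn_trans : transitive gtn.
Proof. by move=> a b c ab ca; apply: ltn_trans ca ab. Qed.

(** Blocks are written in decreasing order, so a cut is forced at an ascent and optional at a
    descent. *)
Fixpoint cuts (u : seq nat) : seq (seq (seq nat)) :=
  if u is x :: v then
    [seq [:: x] :: ss | ss <- cuts v]
    ++ [seq (x :: head [::] ss) :: behead ss
          | ss <- if head x v < x then cuts v else [::]]
  else [:: [::]].

Lemma size_cuts (u : seq nat) : size (cuts u) = 2 ^ descents u.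
Proof.
elim: u => //= x v IHv; rewrite size_cat !size_map descents_cons expnD -IHv.
by case: ifP => _; rewrite ?mul1n ?addn0 //= mulSn mul1n.
Qed.

Definition is_cut (ss : seq (seq nat)) : bool :=
  all (fun B => (B != [::]) && sorted gtn B) ss.

Lemma mem_cuts (u : seq nat) (ss : seq (seq nat)) :
  (ss \in cuts u) = (flatten ss == u) && is_cut ss.
Proof.
elim: u ss => [|x v IHv] ss /=.
  by rewrite inE; case: ss => [|[|y B] ss] /=; rewrite ?andbF.
rewrite mem_cat; apply/idP/idP => [/orP[] /mapP[tt] | /andP[/eqP]].
- by rewrite IHv => /andP[/eqP <- cut_tt] ->; rewrite /= eqxx.
- case: ifP => // lt_hx; rewrite IHv => /andP[/eqP def_v cut_tt] ->.
  case: tt => [|[|y B] tt] //= in def_v cut_tt *; first by rewrite -def_v ltnn in lt_hx.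
  rewrite -def_v /= in lt_hx *.
  by rewrite eqxx lt_hx.
case: ss => [|[|y [|z B]] ss] //= [-> def_v].
  move=> cut_ss; apply/orP; left; apply/mapP; exists ss => //.
  by rewrite IHv def_v eqxx.
case/andP=> /andP[lt_zx sB] cut_ss; apply/orP; right.
apply/mapP; exists ((z :: B) :: ss) => //.
have -> : head x v = z by rewrite -def_v.
by rewrite lt_zx IHv /= -def_v eqxx sB.
Qed.

Lemma cuts_uniq (u : seq nat) : uniq (cuts u).
Proof.
elim: u => //= x v IHv; rewrite cat_uniq map_inj_uniq ?IHv /=; last by move=> ? ? [].
apply/andP; split.
  apply/hasPn => _ /mapP[tt tt_in ->]; apply/mapP => -[tt' _ [ttE _]].
  move: tt_in; case: ifP => // lt_hx; rewrite mem_cuts.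
  case: tt ttE => [|[|? ?] ?] //= _; rewrite ?andbF // => /andP[/eqP def_v _].
  by rewrite -def_v ltnn in lt_hx.
rewrite map_inj_in_uniq; first by case: ifP.
case: ifP => // lt_hx [|B s] [|B' s']; rewrite !mem_cuts /=.
- by [].
- by case/andP=> /eqP def_v; rewrite -def_v ltnn in lt_hx.
- by move=> _ /andP[/eqP def_v]; rewrite -def_v ltnn in lt_hx.
- by move=> _ _ [-> ->].
Qed.

Definition chain_of (j : nat) (ss : seq (seq nat)) : seq {set 'I_j} :=
  [seq [set x : 'I_j | val x \in B] | B <- ss].

Lemma block_index_chain_of (j : nat) (ss : seq (seq nat)) (i : 'I_j) :
  block_index (chain_of j ss) i = find (fun B => val i \in B) ss.
Proof.
rewrite /block_index /chain_of find_map; apply: eq_find => B /=.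
by rewrite inE.
Qed.

(** Within a block the larger letter [y] comes first, so both sides are false; letters of different
    blocks are ordered as their blocks are. *)
Lemma cut_index (ss : seq (seq nat)) (x y : nat) :
    is_cut ss -> uniq (flatten ss) -> x < y ->
    x \in flatten ss -> y \in flatten ss ->
  (find (fun B => x \in B) ss < find (fun B => y \in B) ss)
    = (index x (flatten ss) < index y (flatten ss)).
Proof.
elim: ss => //= B ss IHss /andP[/andP[_ sB] cut_ss] uniq_ss lt_xy.
rewrite !mem_cat !index_cat.
move: uniq_ss; rewrite cat_uniq => /and3P[_ _ uniq_ss].
case: (boolP (x \in B)) => xB; case: (boolP (y \in B)) => yB //=.
- move=> _ _; symmetry; apply: contraTF lt_xy => lt_i; rewrite -leqNgt ltnW //.
  exact: (sorted_ltn_index gtn_trans sB _ _ xB yB lt_i).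
- by rewrite ltn0Sn ltn_addr // index_mem.
- move=> x_in _; rewrite ltn0; symmetry; apply/negbTE; rewrite -leqNgt.
  by rewrite ltnW // ltn_addr // index_mem.
- by move=> x_in y_in; rewrite ltnS ltn_add2l IHss.
Qed.

Lemma chain_lt_chain_of (j : nat) (ss : seq (seq nat)) (x y : 'I_j) :
    is_cut ss -> perm_eq (flatten ss) (iota 0 j) -> x < y ->
  chain_lt (chain_of j ss) x y = (index (val x) (flatten ss) < index (val y) (flatten ss)).
Proof.
move=> cut_ss perm_ss lt_xy; rewrite /chain_lt !block_index_chain_of.
have memss z : (z \in flatten ss) = (z < j) by rewrite (perm_mem perm_ss) mem_iota.
by apply: cut_index; rewrite ?memss ?ltn_ord // (perm_uniq perm_ss) iota_uniq.
Qed.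

Lemma stops_chain_of (j : nat) (ss : seq (seq nat)) :
    is_cut ss -> perm_eq (flatten ss) (iota 0 j) ->
  stops (chain_of j ss) = contains123 (flatten ss).
Proof.
move=> cut_ss perm_ss; have clt := chain_lt_chain_of cut_ss perm_ss.
have uniq_ss : uniq (flatten ss) by rewrite (perm_uniq perm_ss) iota_uniq.
apply/idP/(contains123_index uniq_ss).
  case/existsP=> x /existsP[y /existsP[z /and4P[lt_xy lt_yz]]].
  rewrite !clt // => ix iy; exists (val x), (val y), (val z); split=> //.
  by rewrite (perm_mem perm_ss) mem_iota add0n ltn_ord.
case=> x [y [z [lt_xy lt_yz]]]; rewrite (perm_mem perm_ss) mem_iota /= add0n => lt_z ix iy.
have lt_y := ltn_trans lt_yz lt_z; have lt_x := ltn_trans lt_xy lt_y.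
apply/existsP; exists (Ordinal lt_x); apply/existsP; exists (Ordinal lt_y).
by apply/existsP; exists (Ordinal lt_z); rewrite !clt //= lt_xy lt_yz ix.
Qed.

(** * Restriction of chains and deletion of the largest letter *)

(** Elements satisfying neither [p] nor [q] do not affect which is found first. This serves both for
    the empty blocks dropped by [parent] and for the letter dropped by [rem]. *)
Lemma find_filter_lt (T : Type) (a p q : pred T) (s : seq T) :
    subpred p a -> subpred q a ->
  (find p (filter a s) < find q (filter a s)) = (find p s < find q s).
Proof.
move=> pa qa; elim: s => //= x s IHs.
case: (boolP (a x)) => [_ /= | nax]; first by case: (p x); case: (q x); rewrite ?ltnS.
by rewrite (contraNF (pa x) nax) (contraNF (qa x) nax) ltnS.
Qed.

Lemma chain_lt_parent (m : nat) (c : seq {set 'I_m.+1}) (x y : 'I_m) :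
  chain_lt (parent c) x y
    = chain_lt c (widen_ord (leqnSn m) x) (widen_ord (leqnSn m) y).
Proof.
rewrite /chain_lt /block_index /parent find_filter_lt; last 2 first.
- by move=> B xB; apply/set0Pn; exists x.
- by move=> B yB; apply/set0Pn; exists y.
by rewrite !find_map; congr (_ < _); apply: eq_find => B /=; rewrite inE.
Qed.

Lemma stops_parent (m : nat) (c : seq {set 'I_m.+1}) : stops (parent c) -> stops c.
Proof.
case/existsP=> x /existsP[y /existsP[z /and4P[lt_xy lt_yz]]].
rewrite !chain_lt_parent => cxy cyz.
apply/existsP; exists (widen_ord (leqnSn m) x); apply/existsP; exists (widen_ord (leqnSn m) y).
by apply/existsP; exists (widen_ord (leqnSn m) z); rewrite /= lt_xy lt_yz cxy.
Qed.

Lemma is_node_avoid (m : nat) (c : seq {set 'I_m}) : ~~ stops c -> is_node c.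
Proof.
elim: m c => //= m IHm c avoid_c.
have avoid_p : ~~ stops (parent c) by apply: contra avoid_c; apply: stops_parent.
by rewrite IHm.
Qed.

(** Containment passes from a chain to its descendants, so if the parent avoids the condition, all
    earlier ancestors do. *)
Lemma is_nodeS (m : nat) (c : seq {set 'I_m.+1}) : is_node c = ~~ stops (parent c).
Proof. by rewrite /= andb_idl //; apply: is_node_avoid. Qed.

(** The restricted chain need not be written as a cut: only the comparisons among the remaining
    variables matter, and deleting [m] from the word keeps them. *)
Lemma stops_parent_chain_of (m : nat) (ss : seq (seq nat)) :
    is_cut ss -> perm_eq (flatten ss) (iota 0 m.+1) ->
  stops (parent (chain_of m.+1 ss)) = contains123 (rem m (flatten ss)).
Proof.
move=> cut_ss perm_ss; have clt := chain_lt_chain_of cut_ss perm_ss.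
have uniq_ss : uniq (flatten ss) by rewrite (perm_uniq perm_ss) iota_uniq.
have mem_ss z : (z \in flatten ss) = (z < m.+1) by rewrite (perm_mem perm_ss) mem_iota.
have mem_rem z : (z \in rem m (flatten ss)) = (z < m).
  by rewrite mem_rem_uniq // inE mem_ss ltnS ltn_neqAle.
have index_rem x y : x < m -> y < m ->
    (index x (rem m (flatten ss)) < index y (rem m (flatten ss)))
      = (index x (flatten ss) < index y (flatten ss)).
  move=> lt_x lt_y; rewrite rem_filter // /index find_filter_lt //= => z /eqP -> /=.
    by rewrite ltn_eqF.
  by rewrite ltn_eqF.
apply/idP/(contains123_index (rem_uniq m uniq_ss)).
  case/existsP=> x /existsP[y /existsP[z /and4P[lt_xy lt_yz]]].
  rewrite !chain_lt_parent !clt //= => ix iy.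
  by exists x, y, z; rewrite !index_rem ?ltn_ord // mem_rem ltn_ord.
case=> x [y [z [lt_xy lt_yz]]]; rewrite mem_rem => lt_z.
have lt_y := ltn_trans lt_yz lt_z; have lt_x := ltn_trans lt_xy lt_y.
rewrite !index_rem // => ix iy.
apply/existsP; exists (Ordinal lt_x); apply/existsP; exists (Ordinal lt_y).
by apply/existsP; exists (Ordinal lt_z); rewrite !chain_lt_parent !clt //= lt_xy lt_yz ix.
Qed.

(** * Enumeration of all chains by cut words *)

Definition chains (j : nat) : seq (seq {set 'I_j}) :=
  [seq chain_of j ss | u <- permutations (iota 0 j), ss <- cuts u].

(** A decreasing block is determined by its set of letters; the bound on the letters is needed
    because [chain_of] only sees those below [j]. *)
Lemma chain_of_inj (j : nat) :
  {in [pred ss | is_cut ss && all (gtn j) (flatten ss)] &, injective (chain_of j)}.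
Proof.
elim=> [|B ss IHss] [|B' ss'] //=; rewrite !inE => /andP[/andP[/andP[_ sB] cut_ss]].
rewrite all_cat => /andP[ltB lt_ss] /andP[/andP[/andP[_ sB'] cut_ss']].
rewrite all_cat => /andP[ltB' lt_ss'] [] /setP eqB eq_ss.
have -> : ss = ss' by apply: IHss eq_ss; apply/andP.
congr (_ :: _).
apply: (irr_sorted_eq gtn_trans ltnn) => // x.
have [lt_xj | le_jx] := ltnP x j; first by have := eqB (Ordinal lt_xj); rewrite !inE.
have notin (s : seq nat) : all (gtn j) s -> x \in s = false.
  by move/allP=> lt_s; apply: contraTF le_jx => /lt_s; rewrite -ltnNge.
by rewrite !notin.
Qed.

Lemma chains_uniq (j : nat) : uniq (chains j).
Proof.
apply: allpairs_uniq_dep => [|u _|]; [exact: permutations_uniq | exact: cuts_uniq |].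
move=> p q /allpairsPdep[u [ss [perm_u ss_in ->]]] /allpairsPdep[u' [ss' [perm_u' ss_in' ->]]].
rewrite !mem_cuts in ss_in ss_in' => /= eq_ss.
have [/eqP def_u cut_ss] := andP ss_in; have [/eqP def_u' cut_ss'] := andP ss_in'.
suff eq_s : ss = ss' by rewrite -def_u -def_u' eq_s.
apply: (chain_of_inj _ _ eq_ss); rewrite inE ?cut_ss ?cut_ss' /=.
  apply/allP=> x; rewrite def_u; move: perm_u; rewrite mem_permutations => /perm_mem ->.
  by rewrite mem_iota.
apply/allP=> x; rewrite def_u'; move: perm_u'; rewrite mem_permutations => /perm_mem ->.
by rewrite mem_iota.
Qed.

(** Counting the blocks through each element is the form that passes through [map] and [flatten]. *)
Lemma woc_count (j : nat) (c : seq {set 'I_j}) :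
  (uniq c && partition [set:: c] [set: 'I_j])
    = (set0 \notin c) && [forall x : 'I_j, count (fun B : {set 'I_j} => x \in B) c == 1].
Proof.
apply/andP/andP => [[uniq_c /and3P[/eqP cov /trivIsetP triv]] | [n0 /forallP cnt]].
  rewrite inE => n0; split=> //; apply/forallP => x.
  have : x \in cover [set:: c] by rewrite cov inE.
  case/bigcupP=> B; rewrite inE => Bc xB.
  have := count_uniq_mem B uniq_c; rewrite Bc /= => <-; apply/eqP/eq_in_count => D Dc /=.
  apply/idP/eqP => [xD | -> //].
  apply/eqP/negPn/negP => neq; have := triv D B; rewrite !inE => /(_ Dc Bc neq).
  by rewrite -setI_eq0 => /eqP/setP/(_ x); rewrite !inE xD xB.
split.
  (* A nonempty [B] has an element [x], and every copy of [B] is among the blocks containing [x], of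
     which there is one. *)
  apply: count_mem_uniq => B; apply/eqP; rewrite eqn_leq.
  have [Bc | nBc] := boolP (B \in c); last by rewrite leqn0 (count_memPn nBc).
  rewrite andbC -has_count has_pred1 Bc /=.
  have /set0Pn[x xB] : B != set0 by apply: contraNneq n0 => <-.
  by rewrite -(eqP (cnt x)); apply: sub_count => D /= /eqP ->.
apply/and3P; split; last by rewrite inE.
  apply/eqP/setP=> x; rewrite inE; apply/bigcupP.
  have : has (fun B : {set 'I_j} => x \in B) c by rewrite has_count (eqP (cnt x)).
  by case/hasP=> B Bc xB; exists B; rewrite ?inE.
apply/trivIsetP => B D; rewrite !inE => Bc Dc; apply: contra_neqT.
rewrite -setI_eq0 => /set0Pn[x]; rewrite inE => /andP[xB xD].
have /eqP := cnt x.
elim: c {n0 cnt} Bc Dc => //= E c IHc; rewrite !inE.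
have ct0 F : F \in c -> x \in F -> 0 < count (fun B : {set 'I_j} => x \in B) c.
  by move=> Fc xF; rewrite -has_count; apply/hasP; exists F.
case/orP=> [/eqP BE | Bc]; case/orP=> [/eqP DE | Dc].
- by rewrite BE DE.
- by move: (ct0 D Dc xD); rewrite -BE xB; case: (count _ c).
- by move: (ct0 B Bc xB); rewrite -DE xD; case: (count _ c).
by move: (ct0 B Bc xB) (IHc Bc Dc); case: (x \in E); case: (count _ c).
Qed.

(** Inverse of [chain_of]: [enum] is increasing, so [rev] yields a decreasing block. *)
Definition blocks_of (j : nat) (c : seq {set 'I_j}) : seq (seq nat) :=
  [seq rev (map val (enum B)) | B : {set 'I_j} <- c].

Lemma blocks_ofK (j : nat) (c : seq {set 'I_j}) : chain_of j (blocks_of c) = c.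
Proof.
rewrite /chain_of /blocks_of -map_comp -[RHS]map_id; apply: eq_map => B /=.
by apply/setP=> x; rewrite inE mem_rev mem_map ?mem_enum //; exact: val_inj.
Qed.

Lemma mem_chains (j : nat) (c : seq {set 'I_j}) :
  (c \in chains j) = uniq c && partition [set:: c] [set: 'I_j].
Proof.
rewrite woc_count.
apply/allpairsPdep/andP => [[u [ss [perm_u]]] | [n0 /forallP cnt]].
  rewrite mem_cuts => /andP[/eqP def_u cut_ss] ->.
  move: perm_u; rewrite mem_permutations -{u}def_u => perm_ss.
  split.
    apply/mapP => -[B Bss /esym/eqP]; apply/negP/set0Pn.
    have /andP[B0 _] := allP cut_ss B Bss.
    case: B B0 Bss => // x B _ Bss.
    have lt_xj : x < j.
      have /andP[] // : (0 <= x) && (x < 0 + j).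
      rewrite -mem_iota -(perm_mem perm_ss).
      by apply/flattenP; exists (x :: B); rewrite ?inE ?eqxx.
    by exists (Ordinal lt_xj); rewrite !inE eqxx.
  apply/forallP => x; rewrite /chain_of count_map.
  have : count_mem (val x) (flatten ss) = 1.
    by rewrite (permP perm_ss) count_uniq_mem ?iota_uniq // mem_iota ltn_ord.
  rewrite count_flatten => <-.
  have : uniq (flatten ss) by rewrite (perm_uniq perm_ss) iota_uniq.
  elim: ss {perm_ss cut_ss} => //= B ss IHss; rewrite cat_uniq => /and3P[uB _ /IHss /eqP ->].
  by rewrite inE count_uniq_mem.
exists (flatten (blocks_of c)), (blocks_of c); split; last by rewrite blocks_ofK.
  rewrite mem_permutations.
  (* Multiplicities suffice to show that the flattened blocks permute [iota 0 j]. *)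
  have cntx x : count_mem x (flatten (blocks_of c)) = (x < j).
    rewrite count_flatten -map_comp.
    have [lt_xj | le_jx] := ltnP x j.
      transitivity (count (fun B : {set 'I_j} => Ordinal lt_xj \in B) c); last exact/eqP/cnt.
      elim: (c) => //= B c' ->; congr (_ + _).
      rewrite count_rev count_uniq_mem; last by rewrite map_inj_uniq ?enum_uniq //; exact: val_inj.
      by rewrite -[x]/(val (Ordinal lt_xj)) mem_map ?mem_enum //; exact: val_inj.
    elim: (c) => //= B c' ->; rewrite addn0 count_rev; apply/count_memPn.
    by apply/mapP => -[y _ xE]; rewrite xE leqNgt ltn_ord in le_jx.
  have memx x : (x \in flatten (blocks_of c)) = (x < j).
    by rewrite -has_pred1 has_count cntx lt0b.
  apply: uniq_perm; rewrite ?iota_uniq //; last by move=> x; rewrite memx mem_iota.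
  by apply: count_mem_uniq => x; rewrite cntx memx.
rewrite mem_cuts eqxx /=; apply/allP=> _ /mapP[B Bc ->].
apply/andP; split.
  have /set0Pn[x xB] : B != set0 by apply: contraNneq n0 => <-.
  rewrite -size_eq0 size_rev size_map -cardE -lt0n.
  by apply/card_gt0P; exists x.
rewrite rev_sorted.
apply: (@subseq_sorted _ ltn ltn_trans _ (iota 0 j)); last exact: iota_ltn_sorted.
rewrite -val_enum_ord; apply: map_subseq.
by rewrite enumT; apply: filter_subseq.
Qed.

Lemma card_WOC (j : nat) (P : pred (seq {set 'I_j})) :
  #|[set c in WOC j | P c]| = count P (chains j).
Proof.
rewrite cardE -(size_map val) -size_filter; apply: perm_size.
apply: uniq_perm.
- by rewrite map_inj_uniq ?enum_uniq //; exact: val_inj.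
- by rewrite filter_uniq // chains_uniq.
move=> c; rewrite mem_filter; apply/mapP/andP => [[b] | [Pc c_in]].
  by rewrite mem_enum !inE -mem_chains => /andP[b_in Pb] ->.
(* The length bound of the type loses no chain: the blocks are nonempty and have [j] letters in
   all. *)
have le_c : size c <= j.
  case/allpairsPdep: c_in => u [ss [perm_u ss_in ->]].
  move: ss_in; rewrite mem_cuts size_map => /andP[/eqP def_u cut_ss].
  rewrite mem_permutations in perm_u; have := perm_size perm_u.
  rewrite size_iota -def_u => <-.
  elim: ss cut_ss {def_u} => //= B ss IHss /andP[/andP[B0 _] /IHss].
  by rewrite size_cat; case: B B0 => //= x B _; lia.
by exists (Bseq le_c) => //; rewrite mem_enum !inE -mem_chains c_in.
Qed.

(** * Leaves of the tree as weighted words *)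

(** By [size_cuts], this is the number of chains whose word satisfies [P]. *)
Definition cut_weight (P : pred (seq nat)) (n : nat) : nat :=
  \sum_(u <- permutations (iota 0 n) | P u) 2 ^ descents u.

Definition avoids (u : seq nat) : bool := ~~ contains123 u.

(** These are the words of the leaves that contain the condition; [n.-1] is the largest letter,
    whose deletion gives the parent. *)
Definition stopped (n : nat) (u : seq nat) : bool :=
  contains123 u && avoids (rem n.-1 u).

Lemma count_chains (j : nat) (P : pred (seq {set 'I_j})) (Q : pred (seq nat)) :
    (forall ss, is_cut ss -> perm_eq (flatten ss) (iota 0 j) ->
       P (chain_of j ss) = Q (flatten ss)) ->
  count P (chains j) = cut_weight Q j.
Proof.
move=> PQ; rewrite /chains count_flatten -map_comp sumnE big_map /cut_weight [RHS]big_mkcond /=.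
apply: eq_big_seq => u; rewrite mem_permutations => perm_u /=.
rewrite count_map -size_cuts -(count_predT (cuts u)).
transitivity (count (fun=> Q u) (cuts u)).
  apply: eq_in_count => ss; rewrite mem_cuts => /andP[/eqP def_u cut_ss] /=.
  by rewrite PQ ?def_u.
by case: (Q u); rewrite ?count_pred0.
Qed.

Lemma cut_weight_split (P Q : pred (seq nat)) (n : nat) :
  cut_weight P n = cut_weight (predI P Q) n + cut_weight (predI P (predC Q)) n.
Proof. by rewrite /cut_weight (bigID Q). Qed.

Lemma avoids_rem (x : nat) (u : seq nat) : avoids u -> avoids (rem x u).
Proof. by apply: contra; apply: contains123_subseq; apply: rem_subseq. Qed.

Lemma eq_cut_weight (P Q : pred (seq nat)) (n : nat) :
  P =1 Q -> cut_weight P n = cut_weight Q n.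
Proof. by move=> PQ; apply: eq_bigl. Qed.

Lemma cut_weight_node (n : nat) :
  cut_weight (fun u => avoids (rem n.-1 u)) n
    = cut_weight avoids n + cut_weight (stopped n) n.
Proof.
rewrite (cut_weight_split _ avoids); congr (_ + _); apply: eq_cut_weight => u /=.
  by rewrite andb_idl //; apply: avoids_rem.
by rewrite negbK andbC.
Qed.

Lemma card_leaves (n m : nat) :
  #|leaves n m.+1| = cut_weight (stopped m.+1) m.+1
                     + (m.+1 == n) * cut_weight avoids m.+1.
Proof.
rewrite /leaves.
pose Q u := avoids (rem m u) && ((m.+1 == n) || contains123 u).
rewrite (card_WOC (fun c => is_node c && ((m.+1 == n) || stops c))).
rewrite (@count_chains _ _ Q); last first.
  move=> ss cut_ss perm_ss; rewrite is_nodeS stops_parent_chain_of //.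
  by rewrite stops_chain_of.
rewrite {}/Q; case: eqP => [_ | neq] /=; rewrite ?mul1n ?mul0n ?addn0.
  by rewrite [RHS]addnC -cut_weight_node; apply: eq_cut_weight => u; rewrite andbT.
by apply: eq_cut_weight => u; rewrite andbC.
Qed.

Lemma w_cut_weight (n : nat) : 0 < n ->
  w n = cut_weight avoids n + \sum_(1 <= j < n.+1) cut_weight (stopped j) j.
Proof.
move=> n_gt0; rewrite /w addnC.
have -> : cut_weight avoids n = \sum_(1 <= j < n.+1) (j == n) * cut_weight avoids j.
  rewrite big_nat_recr //= eqxx mul1n big_nat big1 // => j /andP[_ lt_jn].
  by rewrite ltn_eqF.
by rewrite -big_split; apply: eq_big_nat => -[|j] // _; rewrite card_leaves.
Qed.

(** * The numbers [e] and [g] in terms of words *)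

(** Distinct permutations have distinct words and both lists have n! entries, so one inclusion is
    enough. *)
Lemma perm_words (n : nat) :
  perm_eq [seq word s | s : 'S_n] (permutations (iota 0 n)).
Proof.
have word_perm (s : 'S_n) : perm_eq (word s) (iota 0 n).
  apply: uniq_perm; rewrite ?iota_uniq //.
    by rewrite map_inj_uniq ?enum_uniq // => i k /val_inj /perm_inj.
  move=> x; rewrite mem_iota add0n; apply/mapP/idP => [[i _ ->] | lt_xn].
    exact: ltn_ord.
  by exists ((s^-1)%g (Ordinal lt_xn)); rewrite ?mem_enum // permKV.
have uniq_words : uniq [seq word s | s : 'S_n].
  rewrite map_inj_uniq ?enum_uniq // => s t /eq_in_map eq_st.
  by apply/perm.permP => i; apply/val_inj/eq_st; rewrite mem_enum.
apply: uniq_perm => //; first exact: permutations_uniq.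
have sub : {subset [seq word s | s : 'S_n] <= permutations (iota 0 n)}.
  by move=> _ /mapP[s _ ->]; rewrite mem_permutations.
suff le_size : size (permutations (iota 0 n)) <= size [seq word s | s : 'S_n].
  by have [] := uniq_min_size uniq_words sub le_size.
by rewrite size_permutations ?iota_uniq // size_iota size_map -cardE card_Sn.
Qed.

Lemma card_words (n : nat) (P : pred (seq nat)) :
  #|[set s : 'S_n | P (word s)]| = count P (permutations (iota 0 n)).
Proof.
rewrite -(permP (perm_words n)) count_map cardE -size_filter; apply: perm_size.
apply: uniq_perm; rewrite ?filter_uniq -?enumT ?enum_uniq // => s.
by rewrite mem_enum !inE mem_filter mem_enum andbT.
Qed.

Lemma sum_count_descents (P : pred (seq nat)) (m n : nat) :
    {in permutations (iota 0 n), forall u, P u -> descents u < m} ->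
  \sum_(0 <= d < m) 2 ^ d * count (fun u => P u && (descents u == d)) (permutations (iota 0 n))
    = cut_weight P n.
Proof.
move=> lt_m; rewrite /cut_weight.
transitivity (\sum_(0 <= d < m) \sum_(u <- permutations (iota 0 n) | P u) (descents u == d) * 2 ^ d).
  apply: eq_bigr => d _; rewrite -sum1_count big_distrr /= !big_mkcond /=.
  by rewrite [RHS]big_mkcond; apply: eq_bigr => u _; case: (P u); case: eqP => // _; rewrite ?muln1 ?mul1n.
rewrite exchange_big /=; rewrite big_seq_cond [RHS]big_seq_cond; apply: eq_bigr => u /andP[u_in Pu].
have lt_u := lt_m u u_in Pu; rewrite big_mkord (bigD1 (Ordinal lt_u)) //= eqxx mul1n.
rewrite big1 ?addn0 // => i; rewrite -val_eqE /= eq_sym => /negPf -> //.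
Qed.

Lemma sum_e (n : nat) : 0 < n ->
  \sum_(0 <= d < n) 2 ^ d * e n d = cut_weight avoids n.
Proof.
move=> n_gt0; rewrite -(@sum_count_descents _ n) => [|u].
  apply: eq_bigr => d _; congr (_ * _).
  exact: (card_words n (fun u => avoids u && (descents u == d))).
rewrite mem_permutations => perm_u _.
by have := descents_ascents_perm perm_u; lia.
Qed.

Lemma descents0_sorted (u : seq nat) : uniq u -> descents u = 0 -> sorted ltn u.
Proof.
elim: u => // x [|y v] IHv // /andP[]; rewrite inE negb_or => /andP[neq_xy _] uniq_v.
rewrite descents_cons /= => /eqP; rewrite addn_eq0 eqb0 -leqNgt => /andP[le_xy /eqP d0].
by rewrite ltn_neqAle neq_xy le_xy; apply: IHv.
Qed.

Lemma rem_iota_last (m : nat) : rem m (iota 0 m.+1) = iota 0 m.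
Proof.
rewrite rem_filter ?iota_uniq // -addn1 iotaD filter_cat /= eqxx cats0.
by apply/all_filterP/allP => x; rewrite mem_iota /= => ltx; rewrite ltn_eqF.
Qed.

Lemma contains123_iota (m : nat) : 2 < m -> contains123 (iota 0 m).
Proof.
case: m => [|[|[|m]]] // _; apply/contains123P; exists 0, 1, 2; split=> //.
by rewrite /= sub0seq.
Qed.

Lemma stopped_small (n : nat) (u : seq nat) : n < 3 ->
  u \in permutations (iota 0 n) -> ~~ stopped n u.
Proof.
move=> lt_n3; rewrite mem_permutations => perm_u; rewrite negb_and; apply/orP; left.
apply/negP => /contains123_ascents.
by have := descents_ascents_perm perm_u; lia.
Qed.

Lemma perm_iota_descents0 (n : nat) (u : seq nat) :
  perm_eq u (iota 0 n) -> descents u = 0 -> u = iota 0 n.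
Proof.
move=> perm_u d0; apply: (irr_sorted_eq ltn_trans ltnn); last exact: perm_mem.
  by apply: descents0_sorted; rewrite ?(perm_uniq perm_u) ?iota_uniq.
exact: iota_ltn_sorted.
Qed.

(** Without descents the word is the identity, which still contains 123 after its last letter is
    deleted, as [n > 3]. The upper bound comes from the two ascents that 123 forces. *)
Lemma stopped_descents (n : nat) (u : seq nat) : 3 < n ->
  u \in permutations (iota 0 n) -> stopped n u -> 0 < descents u <= n - 3.
Proof.
case: n => // n lt_3n; rewrite mem_permutations => perm_u /andP[stop_u].
rewrite [n.+1.-1]/= => avoid_u; apply/andP; split.
  rewrite lt0n; apply: contraNneq avoid_u => /(perm_iota_descents0 perm_u) ->.
  by rewrite rem_iota_last contains123_iota.
have := contains123_ascents stop_u.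
by have := descents_ascents_perm perm_u; lia.
Qed.

Lemma gE (j d : nat) : 2 < j -> d <= j - 3 ->
  g j d = count (fun u => stopped j u && (descents u == d)) (permutations (iota 0 j)).
Proof.
move=> lt_2j le_d; rewrite /g /G le_d andbT; case: (ltnP 3 j) => [lt_3j | le_j3] /=.
  case: posnP => [-> | d_gt0].
    rewrite (gtn_eqF lt_3j) cards0; apply/esym/eqP; rewrite eqn0Ngt -has_count.
    apply/hasPn => u u_in; apply/negP => /andP[/(stopped_descents lt_3j u_in)].
    by case/andP=> d_gt0 _ /eqP d0; rewrite d0 in d_gt0.
  rewrite -card_words; apply: eq_card => s; rewrite !inE /stopped.
  by rewrite -andbA; congr (_ && _); rewrite andbC.
have j3 : j = 3 by lia.
have d0 : d = 0 by move: le_d; rewrite j3; lia.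
rewrite {}j3 {}d0 eqxx cards1 => {lt_2j le_d le_j3}.
have in3 : iota 0 3 \in permutations (iota 0 3) by rewrite mem_permutations.
(* The 1 becomes the multiplicity of [iota 0 3] among the words, since this is the only word without
   descents. *)
rewrite -[LHS]/(nat_of_bool true) -{}in3 -(count_uniq_mem _ (permutations_uniq _)).
apply: eq_in_count => u; rewrite mem_permutations => perm_u /=.
apply/eqP/andP => [-> | [_ /eqP /(perm_iota_descents0 perm_u) //]].
split=> //; apply/andP; split; first exact: (@contains123_iota 3).
by apply/negP => /contains123_ascents.
Qed.

Lemma sum_g (j : nat) : 2 < j ->
  \sum_(0 <= d < (j - 3).+1) 2 ^ d * g j d = cut_weight (stopped j) j.
Proof.
move=> lt_2j; rewrite -(@sum_count_descents _ (j - 3).+1) => [|u u_in stop_u].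
  by apply: eq_big_nat => d; rewrite ltnS => /andP[_ le_d]; rewrite gE.
have [lt_3j | le_j3] := ltnP 3 j.
  by have /andP[] := stopped_descents lt_3j u_in stop_u.
have j3 : j = 3 by lia.
have /andP[/contains123_ascents asc_u _] := stop_u.
move: u_in; rewrite mem_permutations => perm_u.
by have := descents_ascents_perm perm_u; lia.
Qed.

Lemma sum_stopped (n : nat) :
  \sum_(1 <= j < n.+1) cut_weight (stopped j) j
    = \sum_(3 <= j < n.+1) \sum_(0 <= d < (j - 3).+1) 2 ^ d * g j d.
Proof.
have stopped0 j : j < 3 -> cut_weight (stopped j) j = 0.
  move=> lt_j3; rewrite /cut_weight big_seq_cond big_pred0 // => u.
  by apply/negP => /andP[/(stopped_small lt_j3)/negP].
transitivity (\sum_(3 <= j < n.+1) cut_weight (stopped j) j); last first.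
  by apply: eq_big_nat => j /andP[lt_2j _]; rewrite sum_g.
case: n => [|[|n]]; first by rewrite !big_geq.
  by rewrite big_nat1 [RHS]big_geq ?stopped0.
rewrite (@big_cat_nat _ _ _ 3) //= big_nat big1 // => j /andP[_].
exact: stopped0.
Qed.

Lemma w_sum (n : nat) : 0 < n ->
  w n = \sum_(0 <= d < n) 2 ^ d * e n d
        + \sum_(3 <= j < n.+1) \sum_(0 <= d < (j - 3).+1) 2 ^ d * g j d.
Proof. by move=> n_gt0; rewrite sum_e // w_cut_weight // sum_stopped. Qed.

(** * Inserting the largest letter *)

Fixpoint insertions (x : nat) (u : seq nat) : seq (seq nat) :=
  (x :: u) :: if u is y :: v then map (cons y) (insertions x v) else [::].

Lemma mem_insertions (x : nat) (u v : seq nat) :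
  x \notin u -> (v \in insertions x u) = (x \in v) && (rem x v == u).
Proof.
elim: u v => [|y u IHu] [|a v] //=.
- by rewrite !inE eqseq_cons [x == a]eq_sym; case: eqP => //= _; rewrite andbF.
- by move=> _; rewrite inE; apply/mapP => -[].
rewrite !inE negb_or eqseq_cons [x == a]eq_sym => /andP[neq_xy xu].
case: (eqVneq a x) => [-> | neq_ax] /=.
  by case: eqP => //= _; apply/mapP => -[t _ [xy _]]; rewrite xy eqxx in neq_xy.
rewrite eqseq_cons; apply/mapP/and3P => [[t t_in [-> ->]] | [xv /eqP -> eq_u]].
  by move: t_in; rewrite IHu // eqxx => /andP[-> ->].
by exists v => //; rewrite IHu // xv.
Qed.

Lemma insertions_uniq (x : nat) (u : seq nat) : x \notin u -> uniq (insertions x u).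
Proof.
elim: u => //= y u IHu; rewrite inE negb_or => /andP[neq_xy xu].
rewrite map_inj_uniq ?IHu ?andbT //; last by move=> ? ? [].
by apply/mapP => -[t _ [xy _]]; rewrite xy eqxx in neq_xy.
Qed.

Lemma iotaS_perm (m : nat) : perm_eq (iota 0 m.+1) (m :: iota 0 m).
Proof. by rewrite -addn1 iotaD cats1 perm_rcons. Qed.

Lemma perm_insertions (m : nat) :
  perm_eq (permutations (iota 0 m.+1))
          [seq v | u <- permutations (iota 0 m), v <- insertions m u].
Proof.
have notin u : u \in permutations (iota 0 m) -> m \notin u.
  by rewrite mem_permutations => /perm_mem ->; rewrite mem_iota /= add0n ltnn.
apply: uniq_perm; first exact: permutations_uniq.
  apply: allpairs_uniq_dep => [|u u_in|]; first exact: permutations_uniq.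
    by rewrite insertions_uniq // notin.
  move=> p q /allpairsPdep[u [v [u_in v_in ->]]] /allpairsPdep[u' [v' [u'_in v'_in ->]]] /= eq_v.
  suff eq_u : u = u' by rewrite eq_u eq_v.
  move: v_in v'_in; rewrite !mem_insertions ?notin // eq_v.
  by move=> /andP[_ /eqP <-] /andP[_ /eqP <-].
move=> v; rewrite mem_permutations.
apply/idP/allpairsPdep => [perm_v | [u [t [u_in t_in ->]]]].
  have mv : m \in v by rewrite (perm_mem perm_v) mem_iota /= add0n.
  have u_in : rem m v \in permutations (iota 0 m).
    rewrite mem_permutations -(perm_cons m) -(permPl (perm_to_rem mv)).
    by rewrite (permPl perm_v) iotaS_perm.
  by exists (rem m v), v; rewrite mem_insertions ?notin // mv eqxx.
have m_u := notin u u_in; move: t_in; rewrite mem_insertions // => /andP[mt /eqP rem_t].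
rewrite (permPl (perm_to_rem mt)) rem_t (permPr (iotaS_perm m)) perm_cons.
by rewrite -mem_permutations.
Qed.

(** With d descents and k letters, inserting [x] inside a descent or at the end keeps d; each of the
    other k - d places adds a descent. The total is 2^d (2k + 1 - d), stated without subtraction. *)
Lemma sum_insertions (x : nat) (u : seq nat) : {in u, forall y, y < x} ->
  \sum_(v <- insertions x u) 2 ^ descents v + 2 ^ descents u * descents u
    = 2 ^ descents u * (2 * size u).+1.
Proof.
(* The induction leaves the front place aside, as its contribution does not follow the recursion. *)
have inner y (t : seq nat) : {in t, forall z, z < x} -> y < x ->
    \sum_(v <- insertions x t) 2 ^ descents (y :: v)
      + 2 ^ descents (y :: t) * descents (y :: t)
    = 2 ^ descents (y :: t) * (2 * size t).+1.
  elim: t y => [|z t IHt] y lt_x lt_yx /=.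
    have des1 a : descents [:: a] = 0 by rewrite descents_cons /= ltnn.
    by rewrite big_seq1 descents_cons /= !des1 [x < y]ltnNge ltnW.
  have lt_zx : z < x by apply: lt_x; rewrite inE eqxx.
  have lt_tx : {in t, forall s, s < x} by move=> s st; apply: lt_x; rewrite inE st orbT.
  have {}IHt := IHt z lt_tx lt_zx; rewrite big_cons big_map (descents_cons y (x :: _)).
  rewrite (descents_cons x) (descents_cons y) /= lt_zx [x < y]ltnNge (ltnW lt_yx) /=.
  rewrite (eq_bigr (fun v => 2 ^ (z < y) * 2 ^ descents (z :: v))); last first.
    by move=> v _; rewrite (descents_cons y) expnD.
  move: IHt; rewrite -big_distrr /= !expnD; move: (\sum_(v <- _) _) (descents _) => S D.
  by case: (z < y); move: (2 ^ D) => P /=; rewrite ?expn1 ?expn0; nia.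
case: u => [|y t] lt_x /=; first by rewrite big_seq1.
have lt_yx : y < x by apply: lt_x; rewrite inE eqxx.
have lt_tx : {in t, forall s, s < x} by move=> s st; apply: lt_x; rewrite inE st orbT.
have := inner y t lt_tx lt_yx; rewrite [in X in _ -> X]big_cons big_map.
by rewrite (descents_cons x) /= lt_yx expnD expn1; nia.
Qed.

Lemma cut_weight_insertions (m : nat) :
  cut_weight (fun u => avoids (rem m u)) m.+1
    + \sum_(u <- permutations (iota 0 m) | avoids u) 2 ^ descents u * descents u
    = cut_weight avoids m * (2 * m).+1.
Proof.
rewrite /cut_weight (perm_big _ (perm_insertions m)) /= big_mkcond big_allpairs_dep /=.
rewrite (eq_big_seq (fun u => if avoids u then \sum_(v <- insertions m u) 2 ^ descents v else 0)).
  rewrite -big_mkcond -big_split big_distrl /=; rewrite big_seq_cond [RHS]big_seq_cond.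
  apply: eq_bigr => u /andP[]; rewrite mem_permutations => perm_u _.
  rewrite sum_insertions => [|y]; first by rewrite (perm_size perm_u) size_iota.
  by rewrite (perm_mem perm_u) mem_iota.
move=> u; rewrite mem_permutations => perm_u.
have m_u : m \notin u by rewrite (perm_mem perm_u) mem_iota /= add0n ltnn.
rewrite -big_mkcond big_seq_cond; case: ifP => avoid_u; last first.
  by rewrite big_pred0 // => v; rewrite mem_insertions //; case: eqP => [->|]; rewrite ?avoid_u andbF.
rewrite [RHS]big_seq; apply: eq_bigl => v; rewrite andb_idr // mem_insertions //.
by case/andP=> _ /eqP ->.
Qed.

(** From order n to n + 1, each avoiding leaf of level n is replaced by its children, and all other
    leaves stay. *)
Lemma w_rec (n : nat) : 0 < n ->
  w n.+1 + \sum_(u <- permutations (iota 0 n) | avoids u) 2 ^ descents u * descents u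
    = w n + cut_weight avoids n * (2 * n).
Proof.
move=> n_gt0; rewrite !w_cut_weight // big_nat_recr //=.
have := cut_weight_insertions n; have := cut_weight_node n.+1.
rewrite [n.+1.-1]/= mulnS => -> ins.
by rewrite [RHS]addnAC -ins [X in _ + X + _]addnC addnA addnAC.
Qed.

(** * Avoiders with marked ascents *)

(* Counts the nonnegative paths from height c to 0 with k up steps (and k + c
   down steps). *)
Fixpoint ballot (k : nat) : nat -> nat :=
  if k is k'.+1 then
    fix ballot_k c :=
      if c is c'.+1 then ballot_k c' + ballot k' c'.+2 else ballot k' 1
  else fun=> 1.

Lemma ballotS0 (k : nat) : ballot k.+1 0 = ballot k 1.
Proof. by []. Qed.

Lemma ballotSS (k c : nat) : ballot k.+1 c.+1 = ballot k.+1 c + ballot k c.+2.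
Proof. by []. Qed.

(** The ballot formula, by induction along the recursion. Only c = 0, the Catalan numbers, is used
    later, but the recursion needs all heights. *)
Lemma ballot_bin (k c : nat) : (c + k).+1 * ballot k c = c.+1 * 'C(k.*2 + c, k).
Proof.
elim: k c => [|k IHk] c; first by rewrite addn0 bin0.
elim: c => [|c IHc].
  have := IHk 1; have := mul_bin_left k.*2.+1 k.
  rewrite ballotS0 addn1 addn0 doubleS (binS k.*2.+1) (_ : k.*2.+1 - k = k.+1); last by lia.
  by move/eqP; rewrite eqn_pmul2l // => /eqP ->; lia.
rewrite ballotSS; have := IHk c.+2; have := mul_bin_left (k.+1.*2 + c) k.
rewrite (_ : k.*2 + c.+2 = k.+1.*2 + c); last by lia.
rewrite [k.+1.*2 + c.+1]addnS (binS (k.+1.*2 + c)).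
rewrite (_ : k.+1.*2 + c - k = k + c.+2); last by lia.
move: IHc; move: (ballot k.+1 c) (ballot k c.+2) 'C(_, k.+1) 'C(_, k) => B1 B2 X Y.
move=> defB1 eqXY defB2; apply/eqP; rewrite -(@eqn_pmul2l (c + k).+2) //; apply/eqP.
(* The two terms have denominators c + k + 2 and c + k + 3; everything is brought to their
   product. *)
have {defB1} := congr1 (muln (c + k).+3) defB1.
have {defB2} := congr1 (muln (c + k).+2) defB2.
by lia.
Qed.

(* Such paths with [b - s] up steps and s marked down steps, a marked step
   contracting a factor up-down-down, that is an ascent.  In [count_marked], b and
   c are the numbers of unused letters below and above the current minimum. *)
Definition marked (s b c : nat) : nat :=
  if s <= b then ballot (b - s) c * 'C(b - s + c, s) else 0.

(** The count after an unmarked down step, which is impossible at height 0. *)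
Definition marked_prev (s b c : nat) : nat :=
  if c is c'.+1 then marked s b c' else 0.

(** Right after a new minimum, taking a larger letter is an ascent, and marking it spends one of the
    [s] marks. *)
Definition marked_after_min (s b c : nat) : nat :=
  marked s b c + (if s is s'.+1 then marked_prev s' b c else 0).

(** The first step of the path is a down step, an up step or a marked down step, the last using up
    one letter below the minimum. The proof combines the ballot recursion with Pascal's rule. *)
Lemma marked_step (s b c : nat) :
  marked s b.+1 c = marked_prev s b.+1 c + marked s b c.+1
                    + (if s is s'.+1 then marked_prev s' b c else 0).
Proof.
rewrite /marked_prev /marked; case: (leqP s b) => [le_sb | lt_bs].
  rewrite (leqW le_sb) subSn //; case: c => [|c].
    by rewrite ballotS0 addn0 addn1; case: s {le_sb} => [|s]; rewrite ?addn0.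
  rewrite ballotSS addSnnS; case: s le_sb => [|s] le_sb; first by rewrite !bin0; lia.
  rewrite ltnW // (_ : b - s = (b - s.+1).+1); last by lia.
  move: (b - s.+1) => k. rewrite !addSn !addnS binS; nia.
case: (ltngtP s b.+1) => [lt_sb|lt_bs1|->]; first by lia.
  case: s {lt_bs} lt_bs1 => // s; rewrite ltnS => lt_bs.
  by case: c => //= c; rewrite [s <= b]leqNgt lt_bs.
rewrite subnn leqnn subnn; case: c => [|c]; first by rewrite bin0n muln0.
by rewrite /= !mul1n !add0n binS addn0.
Qed.

Lemma marked_first (s b c : nat) : 0 < b + c ->
  marked s b c = marked_prev s b c
    + \sum_(0 <= i < b) marked_after_min s (b - i.+1) (c + i).
Proof.
elim: b c => [|b IHb] c.
  by rewrite big_geq // addn0; case: c => // c _; case: s => [|s]; rewrite /marked_prev /marked ?subnn ?bin0.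
move=> _; rewrite marked_step big_nat_recl // subSS subn0 addn0 -addnA; congr (_ + _).
rewrite IHb ?addnS // /= {1}/marked_after_min -!addnA; congr (_ + _).
by rewrite addnC; congr (_ + _); apply: eq_bigr => i _; rewrite subSS addSnnS.
Qed.

(** * Avoiders by their first letter *)

Lemma sum_permutations_cons (l : seq nat) (P : pred (seq nat)) (F : seq nat -> nat) :
    uniq l -> 0 < size l ->
  \sum_(u <- permutations l | P u) F u
    = \sum_(x <- l) \sum_(t <- permutations (rem x l) | P (x :: t)) F (x :: t).
Proof.
move=> uniq_l l_gt0; rewrite (perm_big _ (permutationsE l_gt0)) undup_id //=.
by rewrite big_mkcond big_allpairs_dep; apply: eq_bigr => x _; rewrite -big_mkcond.
Qed.

Lemma ascents_cons_max (x : nat) (u : seq nat) :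
  {in u, forall y, y < x} -> ascents (x :: u) = ascents u.
Proof.
case: u => [|y u] max_x /=; first by rewrite ltnn.
by rewrite ltnNge ltnW ?max_x ?inE ?eqxx.
Qed.

(** Here [mu] stands for the smallest letter read so far and [l] for the unread letters. *)
Definition avoiders_above (mu : nat) (l : seq nat) (F : seq nat -> nat) : nat :=
  \sum_(u <- permutations l | avoids (mu :: u)) F u.

Lemma avoiders_above_perm (mu : nat) (l l' : seq nat) (F : seq nat -> nat) :
  perm_eq l l' -> avoiders_above mu l F = avoiders_above mu l' F.
Proof. by move=> eq_l; apply/perm_big/perm_permutations. Qed.

Lemma eq_avoiders_above (mu : nat) (l : seq nat) (F F' : seq nat -> nat) :
    (forall u, perm_eq u l -> F u = F' u) ->
  avoiders_above mu l F = avoiders_above mu l F'.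
Proof.
move=> FF'; rewrite /avoiders_above big_seq_cond [RHS]big_seq_cond.
by apply: eq_bigr => u /andP[]; rewrite mem_permutations => /FF' ->.
Qed.

Lemma perm_rem_cat (x : nat) (l1 l2 : seq nat) :
  perm_eq (rem x (l1 ++ x :: l2)) (l1 ++ l2).
Proof.
rewrite -(perm_cons x) -(permPl (perm_to_rem _)) ?mem_cat ?inE ?eqxx ?orbT //.
by rewrite perm_catC /= perm_cons perm_catC.
Qed.

(** Taking a letter y above [mu] other than the largest one x would leave the occurrence mu, y, x.
    The largest one can be taken, and it does not constrain the rest. *)
Lemma avoiders_above_high (mu : nat) (l l' : seq nat) (F : seq nat -> nat) :
    sorted gtn (l ++ mu :: l') ->
  \sum_(x <- l) \sum_(t <- permutations (rem x (l ++ l')) | avoids (mu :: x :: t)) F (x :: t)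
    = if l is x :: l1 then avoiders_above mu (l1 ++ l') (fun t => F (x :: t)) else 0.
Proof.
rewrite (sorted_pairwise gtn_trans) pairwise_cat /=.
case/and3P=> /allrelP high_l; case: l high_l => [|x l] high_l; first by rewrite big_nil.
case/andP=> /allP max_x _ /andP[/allP low_l' _].
rewrite big_cons /= eqxx [X in _ + X]big_seq [X in _ + X]big1 ?addn0 => [|y y_l].
  rewrite /avoiders_above big_seq_cond [RHS]big_seq_cond; apply: eq_bigl => t.
  rewrite mem_permutations; case: (boolP (perm_eq _ _)) => //= perm_t.
  rewrite /avoids contains123_cons2_max // => z.
  rewrite (perm_mem perm_t) mem_cat => /orP[/max_x // | z_l'].
  apply: ltn_trans (low_l' z z_l') (high_l x mu _ _); by rewrite inE eqxx.
have lt_yx : y < x := max_x y y_l.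
rewrite big_seq_cond big_pred0 // => t; rewrite mem_permutations.
apply/negbTE/negP => /andP[perm_t /negP[]]; apply/contains123P; exists mu, y, x.
split=> //; first by apply: high_l; rewrite inE ?eqxx ?y_l ?orbT.
rewrite /= !eqxx sub1seq (perm_mem perm_t) (gtn_eqF lt_yx) /=.
by rewrite inE eqxx.
Qed.

(** A smaller letter replaces [mu] as minimum, and the [i] skipped letters join those above. *)
Lemma avoiders_above_low (mu : nat) (l l' : seq nat) (F : seq nat -> nat) :
    sorted gtn (l ++ mu :: l') ->
  \sum_(x <- l') \sum_(t <- permutations (rem x (l ++ l')) | avoids (mu :: x :: t)) F (x :: t)
    = \sum_(0 <= i < size l')
        avoiders_above (nth 0 l' i) ((l ++ take i l') ++ drop i.+1 l')
                       (fun t => F (nth 0 l' i :: t)).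
Proof.
rewrite (sorted_pairwise gtn_trans) pairwise_cat /= => /and3P[_ _ /andP[/allP low_l' _]].
rewrite (big_nth 0); apply: eq_big_nat => i /andP[_ lt_i].
set x := nth 0 l' i; have lt_x : x < mu by apply/low_l'/mem_nth.
have def_l' : l' = take i l' ++ x :: drop i.+1 l' by rewrite -drop_nth ?cat_take_drop.
rewrite -(avoiders_above_perm _ _ (_ : perm_eq (rem x (l ++ l')) _)).
  by apply: eq_bigl => t; rewrite /avoids contains123_cons2_lt.
by rewrite {1}def_l' catA perm_rem_cat.
Qed.

(** The binomial counts the choices of [s] marked ascents. The two claims, without and with a
    possible ascent from [mu] to the first letter, are proved together by induction on the number of
    unread letters. *)
Lemma count_marked (l l' : seq nat) (mu s : nat) : sorted gtn (l ++ mu :: l') ->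
  avoiders_above mu (l ++ l') (fun u => 'C(ascents u, s)) = marked s (size l') (size l)
  /\ avoiders_above mu (l ++ l') (fun u => 'C(ascents (mu :: u), s))
     = marked_after_min s (size l') (size l).
Proof.
have [n] := ubnP (size l + size l'); elim: n l l' mu s => // n IHn l l' mu s lt_n sorted_l.
have max_l x l1 : l = x :: l1 -> {in l1 ++ l', forall y, y < x}.
  move=> def_l y y_in; move: sorted_l; rewrite def_l /= (path_sortedE gtn_trans).
  case/andP=> /allP max_x _; apply: max_x.
  by move: y_in; rewrite !mem_cat inE => /orP[] ->; rewrite ?orbT.
have low_l' : {in l', forall y, y < mu}.
  move: sorted_l; rewrite (sorted_pairwise gtn_trans) pairwise_cat /=.
  by case/and3P=> _ _ /andP[/allP].
have [l0 | l_gt0] := posnP (size (l ++ l')).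
  case: l l' l0 {lt_n sorted_l max_l low_l'} => [|//] [|//] _.
  have av1 : avoids [:: mu] by apply/negP => /contains123_ascents; rewrite /= ltnn.
  rewrite /avoiders_above !big_cons !big_nil av1 /= ltnn /marked_after_min.
  by case: s => [|s]; rewrite /marked ?bin0 //= addn0.
have uniq_l : uniq (l ++ l').
  apply: (sorted_uniq gtn_trans ltnn); apply: subseq_sorted sorted_l; first exact: gtn_trans.
  by rewrite cat_subseq // subseq_cons.
(* After a new minimum the second claim applies, since an ascent may follow it. *)
have low F : (forall x t, x \in l' -> F (x :: t) = 'C(ascents (x :: t), s)) ->
    \sum_(0 <= i < size l')
        avoiders_above (nth 0 l' i) ((l ++ take i l') ++ drop i.+1 l')
                       (fun t => F (nth 0 l' i :: t))
    = \sum_(0 <= i < size l') marked_after_min s (size l' - i.+1) (size l + i).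
  move=> FE; apply: eq_big_nat => i /andP[_ lt_i].
  have x_in : nth 0 l' i \in l' by apply: mem_nth.
  rewrite (eq_avoiders_above _ (fun u _ => FE _ u x_in)).
  have size_l1 : size (l ++ take i l') = size l + i by rewrite size_cat size_takel // ltnW.
  rewrite -size_l1 -size_drop; apply: (IHn _ _ _ s _ _).2.
    by rewrite size_l1 size_drop; lia.
  by rewrite -catA -drop_nth // cat_take_drop; apply: subseq_sorted sorted_l;
     [exact: gtn_trans | rewrite cat_subseq // subseq_cons].
(* No ascent starts at the largest unread letter, so the first claim applies. *)
have high x l1 : l = x :: l1 -> forall s',
    avoiders_above mu (l1 ++ l') (fun t => 'C(ascents (x :: t), s'))
      = marked s' (size l') (size l1).
  move=> def_l s'; rewrite (@eq_avoiders_above _ _ _ (fun t => 'C(ascents t, s'))).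
    apply: (IHn _ _ _ s' _ _).1; first by move: lt_n; rewrite def_l /=; lia.
    by move: sorted_l; rewrite def_l /=; apply: path_sorted.
  move=> u perm_u; rewrite ascents_cons_max // => y.
  by rewrite (perm_mem perm_u); apply: max_l def_l _.
have size_gt0 : 0 < size l' + size l by rewrite addnC -size_cat.
have expand F : avoiders_above mu (l ++ l') F
    = (if l is x :: l1 then avoiders_above mu (l1 ++ l') (fun t => F (x :: t)) else 0)
      + \sum_(0 <= i < size l')
          avoiders_above (nth 0 l' i) ((l ++ take i l') ++ drop i.+1 l')
                         (fun t => F (nth 0 l' i :: t)).
  rewrite /avoiders_above sum_permutations_cons // big_cat /=.
  by rewrite -(avoiders_above_high _ sorted_l) -(avoiders_above_low _ sorted_l).
rewrite !{}expand (low (fun u => 'C(ascents u, s))) //.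
rewrite (low (fun u => 'C(ascents (mu :: u), s))) //; last first.
  move=> x t x_in /=; by rewrite [mu < x]ltnNge ltnW ?low_l'.
split.
  rewrite (marked_first s size_gt0); congr (_ + _).
  by case def_l: (l) => [|x l1] //=; apply: high.
rewrite /marked_after_min (marked_first s size_gt0) addnAC; congr (_ + _).
case def_l: (l) => [|x l1] /=; first by case: (s).
have lt_mux : mu < x.
  move: sorted_l; rewrite def_l /= (path_sortedE gtn_trans) => /andP[/allP max_x _].
  by apply: max_x; rewrite mem_cat inE eqxx orbT.
case: (s) => [|s'].
  rewrite addn0 -(high x l1 def_l 0); apply: eq_avoiders_above => u _; by rewrite !bin0.
(* Pascal's rule: the ascent from [mu] to [x] is unmarked or marked. *)
rewrite -!(high x l1 def_l) /avoiders_above -big_split /=.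
by apply: eq_bigr => u _; rewrite lt_mux add1n binS.
Qed.

(** Instance of [count_marked] with the virtual minimum [n], which lies above all letters and so
    imposes nothing. *)
Lemma sum_bin_ascents (n s : nat) : s <= n ->
  \sum_(u <- permutations (iota 0 n) | avoids u) 'C(ascents u, s)
    = ballot (n - s) 0 * 'C(n - s, s).
Proof.
move=> le_sn.
have sorted_l : sorted gtn ([::] ++ n :: rev (iota 0 n)).
  by rewrite -[_ ++ _]revK rev_sorted rev_cons revK -cats1 -[[:: n]]/(iota (0 + n) 1) -iotaD
             iota_ltn_sorted.
have [+ _] := count_marked s sorted_l; rewrite /marked size_rev size_iota le_sn addn0 => <-.
rewrite (avoiders_above_perm _ _ (_ : perm_eq _ (iota 0 n))) ?perm_rev //.
rewrite /avoiders_above big_seq_cond [RHS]big_seq_cond; apply: eq_bigl => u.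
rewrite mem_permutations; case: (boolP (perm_eq _ _)) => //= perm_u.
rewrite /avoids contains123_cons_max // => y.
by rewrite (perm_mem perm_u) mem_iota.
Qed.

(** * Generating function *)

Import Num.Theory.

Local Open Scope ring_scope.

(* The coefficient of x^n in [sum_m 'C(2m, m) (2 x (1 - x))^m], with [m = n - s]. *)
Definition dcoef (n : nat) : rat :=
  \sum_(0 <= s < n.+1)
     (-1) ^+ s * (2 ^ (n - s) * 'C((n - s).*2, n - s) * 'C(n - s, s))%N%:R.

(** The left side is the coefficient of x^n in (1 - x)^a / (1 - 2x)^2. Raising [a] by one takes a
    difference in [n], and the closed form obeys the same rule. *)
Lemma alternating_bin_sum (n a : nat) : (a <= n)%N ->
  \sum_(0 <= s < n.+1) (-1) ^+ s * ('C(a, s) * (2 ^ (n - s) * (n - s).+1))%N%:R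
    = (2 ^ (n - a) * (n + a).+1)%N%:R :> rat.
Proof.
elim: a n => [|a IHa] n le_an.
  rewrite big_nat_recl // big1 => [|s _]; last by rewrite bin0n mulr0.
  by rewrite addr0 bin0 mul1n !subn0 addn0 expr0 mul1r.
case: n le_an => // n le_an.
pose h k := (2 ^ k * k.+1)%N; pose T b m : rat :=
  \sum_(0 <= s < m.+1) (-1) ^+ s * ('C(b, s) * h (m - s))%N%:R.
have {IHa} IHa m : (a <= m)%N -> T a m = (2 ^ (m - a) * (m + a).+1)%N%:R := IHa m.
rewrite -[LHS]/(T a.+1 n.+1); have -> : T a.+1 n.+1 = T a n.+1 - T a n.
  rewrite /T !(big_nat_recl n.+1) // -addrA -sumrB !bin0; congr (_ + _).
  apply: eq_bigr => s _; rewrite subSS binS mulnDl natrD exprS; ring.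
rewrite !IHa //; last exact: leqW.
by rewrite subSS subSn // expnS; ring.
Qed.

Lemma central_binS (i : nat) :
  (i.+1 * 'C(i.+1.*2, i.+1) = (4 * i + 2) * 'C(i.*2, i))%N.
Proof.
rewrite doubleS -mul_bin_diag /=.
have := mul_bin_down i.*2.+1 i; rewrite /= (_ : i.*2.+1 - i = i.+1)%N; last by lia.
by lia.
Qed.

(** With r_i the central binomials, the symmetry of i and n - i turns a weight i into n/2; then (i +
    1) r_(i+1) = (4i + 2) r_i multiplies the sum by 4 when n grows by one. *)
Lemma central_conv (n : nat) :
  (\sum_(i < n.+1) 'C(i.*2, i) * 'C((n - i).*2, n - i) = 4 ^ n)%N.
Proof.
pose r i := 'C(i.*2, i); rewrite -[LHS]/(\sum_(i < n.+1) r i * r (n - i))%N.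
have half m : (2 * \sum_(i < m.+1) i * (r i * r (m - i)) = m * \sum_(i < m.+1) r i * r (m - i))%N.
  rewrite mul2n -addnn {1}(reindex_inj rev_ord_inj) /= -big_split big_distrr /=.
  apply: eq_bigr => i _; rewrite subSS subKn -1?ltnS // [(r (m - i)%N * _)%N]mulnC -mulnDl.
  by rewrite subnK // -ltnS.
elim: n => [|n IHn]; first by rewrite big_ord1.
apply/eqP; rewrite -(@eqn_pmul2l n.+1) // -half big_ord_recl mul0n add0n.
under eq_bigr => i _ do rewrite /= /bump /= add1n subSS mulnA central_binS -mulnA mulnDl -mulnA.
rewrite big_split /= -!big_distrr /= IHn.
have := half n; rewrite IHn => {}half.
by rewrite expnS; apply/eqP; move: half; move: (\sum_(i < _) _)%N => S; lia.
Qed.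

Lemma w_diff (n : nat) : (0 < n)%N -> ((w n.+1)%:R - (w n)%:R) * 2 = dcoef n.
Proof.
move=> n_gt0.
have binE (m : nat) : (m.+1 * ballot m 0 = 'C(m.*2, m))%N.
  by have := ballot_bin m 0; rewrite add0n mul1n addn0.
have des_asc u : u \in permutations (iota 0 n) -> (descents u + ascents u = n.-1)%N.
  by rewrite mem_permutations => /descents_ascents_perm.
(* As d + a = n - 1 for d descents and a ascents, n + a + 1 is the factor 2n - d. *)
have -> : (w n.+1)%:R - (w n)%:R =
    \sum_(u <- permutations (iota 0 n) | avoids u)
      (2 ^ descents u * (n + ascents u).+1)%N%:R :> rat.
  apply/eqP; rewrite subr_eq addrC -natr_sum -natrD eqr_nat.
  rewrite -(eqn_add2r (\sum_(u <- permutations (iota 0 n) | avoids u) 2 ^ descents u * descents u)%N).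
  apply/eqP; rewrite w_rec // -addnA; congr addn; rewrite -big_split /cut_weight big_distrl /=.
  rewrite big_seq_cond [RHS]big_seq_cond; apply: eq_bigr => u /andP[u_in _].
  by rewrite -mulnDr; congr muln; have := des_asc u u_in; lia.
rewrite mulr_suml.
transitivity (\sum_(u <- permutations (iota 0 n) | avoids u) \sum_(0 <= s < n.+1)
    (-1) ^+ s * ('C(ascents u, s) * (2 ^ (n - s) * (n - s).+1))%N%:R : rat).
  rewrite big_seq_cond [RHS]big_seq_cond; apply: eq_bigr => u /andP[u_in _].
  have da := des_asc u u_in; rewrite alternating_bin_sum; last by lia.
  (* The exponent d + 1 absorbs the factor 2 on the left. *)
  rewrite (_ : n - ascents u = (descents u).+1)%N; last by lia.
  by rewrite expnS !natrM; ring.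
(* For fixed s the avoiders with s marked ascents are counted, and the factor n - s + 1 turns the
   Catalan number into a central binomial. *)
rewrite exchange_big /=; apply: eq_big_nat => s; rewrite ltnS => /andP[_ le_sn].
rewrite -mulr_sumr -natr_sum -big_distrl /= sum_bin_ascents // -binE.
by congr (_ * _%:R); lia.
Qed.

Lemma w1 : w 1 = 1%N.
Proof.
rewrite w_sum // big_nat1 big_geq // addn0 mul1n /e.
rewrite (card_words 1 (fun u => avoids u && (descents u == 0%N))).
rewrite -[RHS]/(size [:: [:: 0%N]]) -[[:: [:: 0%N]]]/(permutations (iota 0 1)).
apply/eqP; rewrite -all_count; apply/allP => u; rewrite mem_permutations => perm_u.
rewrite (perm_small_eq _ perm_u) //; apply/andP; split; last by rewrite descents_cons.
by apply/negP => /contains123_ascents.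
Qed.

Lemma dcoef0 : dcoef 0 = 1.
Proof. by rewrite /dcoef big_nat1. Qed.

(** * Series compared with polynomials up to a given degree *)

Definition agree (N : nat) (f : fps rat) (p : {poly rat}) : Prop :=
  forall i, (i < N)%N -> fcoef f i = p`_i.

Lemma agreeM (N : nat) f g p q : agree N f p -> agree N g q -> agree N (f * g) (p * q).
Proof.
move=> fp gq i lt_iN; rewrite coefM; apply: eq_bigr => j _.
have le_ji : (j <= i)%N by rewrite -ltnS.
by rewrite fp ?gq //; [apply: leq_ltn_trans (leq_subr _ _) lt_iN | apply: leq_ltn_trans lt_iN].
Qed.

Lemma agreeD (N : nat) f g p q : agree N f p -> agree N g q -> agree N (f + g) (p + q).
Proof. by move=> fp gq i lt_iN; rewrite coefD -fp // -gq. Qed.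

Lemma agreeN (N : nat) f p : agree N f p -> agree N (- f) (- p).
Proof. by move=> fp i lt_iN; rewrite coefN -fp. Qed.

Lemma agree1 (N : nat) : agree N 1 1.
Proof. by move=> i _; rewrite coef1. Qed.

Lemma agreeX (N : nat) : agree N (fpsX rat) 'X.
Proof. by move=> i _; rewrite coefX. Qed.

Lemma agree_nat (N k : nat) : agree N k%:R k%:R.
Proof.
elim: k => [|k IHk]; first by move=> i _; rewrite coef0.
by rewrite !mulrS; apply: agreeD => //; apply: agree1.
Qed.

(** Truncation of 1 / sqrt (1 - 8x). *)
Definition central_poly (N : nat) : {poly rat} :=
  \poly_(m < N) (2 ^ m * 'C(m.*2, m))%N%:R.

(** By [central_conv] the square has coefficients 8^i below N, those of the geometric series. *)
Lemma central_poly_sqr (N k : nat) : (k < N)%N ->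
  (central_poly N ^+ 2 * (1 - 8%:R * 'X))`_k = (k == 0%N)%:R.
Proof.
have sqr i : (i < N)%N -> (central_poly N ^+ 2)`_i = 8%:R ^+ i.
  move=> lt_iN; rewrite expr2 coefM -natrX -[8%N]/(2 * 4)%N expnMn -central_conv natrM.
  rewrite natr_sum mulr_sumr; apply: eq_bigr => j _.
  have le_ji : (j <= i)%N by rewrite -ltnS.
  rewrite !coef_poly (leq_ltn_trans le_ji) // (leq_ltn_trans (leq_subr _ _) lt_iN).
  by rewrite -[in (2 ^ i)%N](subnKC le_ji) expnD !natrM; ring.
move=> lt_kN; rewrite mulrBr mulr1 mulrA coefB coefMX mulr_natr coefMn.
case: k lt_kN => [|k] lt_kN; first by rewrite subr0 sqr.
by rewrite !sqr // ?(ltnW lt_kN) //= exprSr mulr_natr subrr.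
Qed.

Definition substp : {poly rat} := 'X * (1 - 'X).

Lemma coef_subst_exp (n m : nat) : (m <= n)%N ->
  (substp ^+ m)`_n = (-1) ^+ (n - m) * 'C(m, n - m)%:R.
Proof.
move=> le_mn; rewrite /substp exprMn mulrC coefMXn ltnNge le_mn /=.
move: (n - m)%N => k; rewrite exprDn coef_sum.
have coefNX i : (1 ^+ (m - i) * (- 'X) ^+ i *+ 'C(m, i))`_k
    = (-1) ^+ i * (k == i)%:R *+ 'C(m, i) :> rat.
  rewrite expr1n mul1r (exprNn 'X) coefMn; congr (_ *+ _).
  have -> : (-1) ^+ i = ((-1) ^+ i)%:P :> {poly rat} by rewrite rmorphXn rmorphN1.
  by rewrite coefCM coefXn.
have [le_km | lt_mk] := leqP k m; last first.
  rewrite bin_small // mulr0 big1 // => i _; rewrite coefNX gtn_eqF ?mulr0 ?mul0rn //.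
  exact: leq_trans lt_mk.
rewrite (bigD1 (Ordinal (le_km : (k < m.+1)%N))) //= big1 ?addr0 => [|i].
  by rewrite coefNX eqxx mulr1 mulr_natr.
by rewrite -val_eqE /= eq_sym => /negPf ne; rewrite coefNX ne mulr0 mul0rn.
Qed.

Lemma coef_subst_small (n m : nat) : (n < m)%N -> (substp ^+ m)`_n = 0.
Proof. by move=> lt_nm; rewrite /substp exprMn mulrC coefMXn lt_nm. Qed.

(** The exponent is m = n - s; terms with m > n vanish because x^m divides (x (1 - x))^m. *)
Lemma agree_dcoef (N : nat) : agree N (FPS dcoef) (central_poly N \Po substp).
Proof.
move=> n lt_nN; rewrite /= /central_poly poly_def rmorph_sum coef_sum /=.
rewrite -(big_mkord xpredT (fun m => (((2 ^ m * 'C(m.*2, m))%:R *: 'X^m) \Po substp)`_n)).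
rewrite (@big_cat_nat _ _ _ n.+1) //= [X in _ + X]big_nat [X in _ + X]big1 => [|m].
  rewrite addr0 /dcoef [LHS]big_nat_rev; apply: eq_big_nat => m; rewrite ltnS => /andP[_ le_mn].
  rewrite add0n subSS subKn // comp_polyZ comp_Xn_poly coefZ coef_subst_exp //.
  by rewrite natrM; ring.
by case/andP=> lt_nm _; rewrite comp_polyZ comp_Xn_poly coefZ coef_subst_small ?mulr0.
Qed.

(** Substituting x (1 - x), a multiple of x, preserves the congruence modulo x^N and turns 1 - 8x
    into 1 - 8x + 8x^2. *)
Lemma central_poly_subst_sqr (N k : nat) : (k < N)%N ->
  (((central_poly N \Po substp) * (central_poly N \Po substp)) * (1 - 8%:R * 'X + 8%:R * 'X ^+ 2))`_k
    = (k == 0%N)%:R.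
Proof.
move=> lt_kN; pose q := central_poly N ^+ 2 * (1 - 8%:R * 'X).
have [r def_q] : exists r, q = 1 + r * 'X^N.
  exists (drop_poly N (q - 1)); rewrite addrC; apply: (canRL (subrK 1)).
  rewrite -[LHS](poly_take_drop N) [X in X + _](_ : _ = 0) ?add0r //.
  apply/polyP => i; rewrite coef_take_poly coef0; case: ifP => // lt_iN.
  by rewrite coefB central_poly_sqr // coef1 subrr.
have -> : (central_poly N \Po substp) * (central_poly N \Po substp) * (1 - 8%:R * 'X + 8%:R * 'X ^+ 2)
    = q \Po substp.
  rewrite /q comp_polyM rmorphB /= comp_polyM expr2 comp_polyM comp_polyX.
  rewrite rmorph1 rmorph_nat /substp; ring.
rewrite def_q comp_polyD comp_polyM comp_Xn_poly comp_polyC coefD coef1.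
by rewrite /substp exprMn mulrCA coefXnM lt_kN addr0.
Qed.

Lemma dcoef_sqr :
  FPS dcoef * FPS dcoef * (1 - 8%:R * fpsX rat + 8%:R * fpsX rat ^+ 2) = 1.
Proof.
apply: fpsP => n.
have agr : agree n.+1 (FPS dcoef * FPS dcoef * (1 - 8%:R * fpsX rat + 8%:R * fpsX rat ^+ 2))
  (((central_poly n.+1 \Po substp) * (central_poly n.+1 \Po substp)) * (1 - 8%:R * 'X + 8%:R * 'X ^+ 2)).
  have agX := @agreeX n.+1; have ag8 := @agree_nat n.+1 8; have agD := @agree_dcoef n.+1.
  apply: agreeM (agreeM agD agD) _; apply: agreeD; last by apply: agreeM ag8 (agreeM agX agX).
  by apply: agreeD; [exact: agree1 | exact/agreeN/agreeM].
by rewrite agr // central_poly_subst_sqr.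
Qed.

Lemma fcoefXM (f : fps rat) (n : nat) :
  fcoef (fpsX rat * f) n = if n is m.+1 then fcoef f m else 0.
Proof.
rewrite {1}/GRing.mul /=; case: n => [|n]; first by rewrite big_ord1 /= mul0r.
rewrite 2!big_ord_recl /= mul0r add0r mul1r /bump /= addn0 subSS subn0.
by rewrite big1 ?addr0 // => i _; rewrite mul0r.
Qed.

Lemma fps_unitE (f : fps rat) : (f \is a GRing.unit) = (fcoef f 0 != 0).
Proof. by []. Qed.

(** The product D s squares to 1, and D s + 1 is invertible because its constant coefficient is 2;
    hence D s = 1. *)
Lemma dcoef_sqrt :
  FPS dcoef * fps_sqrt (1 - 8%:R * fpsX rat + 8%:R * fpsX rat ^+ 2) = 1.
Proof.
set f := 1 - _ + _; set s := fps_sqrt f; set D := FPS dcoef.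
have f0 : fcoef f 0 = 1.
  by rewrite /f ![8%:R * _]mulrC expr2 -mulrA /= !big_ord1 /= !mul0r subr0 addr0.
have ss : s ^+ 2 = f by apply: fps_sqrtK.
have : (D * s - 1) * (D * s + 1) = 0.
  rewrite -subr_sqr expr1n exprMn ss expr2 dcoef_sqr subrr //.
have u : D * s + 1 \is a GRing.unit.
  by rewrite fps_unitE /= big_ord1 /= dcoef0 mulr1.
by move/(congr1 (fun h => h / (D * s + 1))); rewrite mul0r mulrK // => /eqP; rewrite subr_eq0 => /eqP.
Qed.

(** Multiplying by 1 - x takes differences, given by [w_diff] from x^2 on. At x^1 the value is 2 = 1
    + [dcoef 0], which explains the added 1. *)
Lemma W_dcoef : 2%:R * (1 - fpsX rat) * W = fpsX rat * (1 + FPS dcoef).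
Proof.
rewrite -mulrA mulrBl mul1r mulr2n mulrDl !mul1r.
apply: fpsP => n; rewrite fcoefXM.
have fcoefD (a b : fps rat) i : fcoef (a + b) i = fcoef a i + fcoef b i by [].
have fcoefN (a : fps rat) i : fcoef (- a) i = - fcoef a i by [].
rewrite !fcoefD !fcoefN fcoefXM; case: n => [|[|n]].
- by rewrite /= subr0 addr0.
- by rewrite /= w1 dcoef0 subr0.
by rewrite fcoefD /= add0r -w_diff // mulr_natr mulr2n.
Qed.

Lemma W_sqrt :
  (let x := fpsX rat in
   let s := fps_sqrt (1 - 8%:R * x + 8%:R * x ^+ 2) in
   W = (x + x * s) / (2%:R * (1 - x) * s))%R.
Proof.
move=> x s; have u : 2%:R * (1 - x) * s \is a GRing.unit.
  by rewrite fps_unitE /= !big_ord1.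
apply: (canRL (mulrK u)); rewrite mulrCA [LHS]mulrA {1}/x W_dcoef.
rewrite -mulrA mulrDl mul1r dcoef_sqrt -/s -/x; ring.
Qed.

Local Close Scope ring_scope.

(** * The first eight values *)

(** Separating the signs keeps the recurrence in natural numbers, ready for computation. *)
Lemma w_rec_nat (n : nat) (t := fun s => 2 ^ (n - s) * 'C((n - s).*2, n - s) * 'C(n - s, s)) :
    0 < n ->
  w n.+1 * 2 + \sum_(0 <= s < n.+1) odd s * t s
    = w n * 2 + \sum_(0 <= s < n.+1) ~~ odd s * t s.
Proof.
move=> n_gt0; have diff := w_diff n_gt0.
apply/eqP; rewrite -(eqr_nat rat) !natrD !natrM; apply/eqP.
have -> : ((w n.+1)%:R * 2 = (w n)%:R * 2 + dcoef n :> rat)%R by rewrite -diff; ring.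
rewrite -addrA; congr (_ + _)%R; rewrite /dcoef !natr_sum -big_split; apply: eq_bigr => s _.
by rewrite -signr_odd -/(t s); case: (odd s); rewrite /= !natrM; ring.
Qed.

Lemma w_values :
  [seq w n | n <- iota 1 8] =
    [seq nat_of_bin k
       | k <- [:: 1; 3; 13; 69; 401; 2433; 15121; 95441]%num].
Proof.
pose cb k := 'C(k.*2, k).
have cbS k : k.+1 * cb k.+1 = (4 * k + 2) * cb k := central_binS k.
have w_cb n : 0 < n ->
    w n.+1 * 2 + \sum_(0 <= s < n.+1) odd s * (2 ^ (n - s) * cb (n - s) * 'C(n - s, s))
    = w n * 2 + \sum_(0 <= s < n.+1) ~~ odd s * (2 ^ (n - s) * cb (n - s) * 'C(n - s, s)).
  exact: w_rec_nat.
have c0 : cb 0 = 1 by [].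
(* Rewriting below must not try to evaluate the central binomials. *)
clearbody cb.
have c1 : cb 1 = 2 by have := cbS 0; lia.
have c2 : cb 2 = 6 by have := cbS 1; lia.
have c3 : cb 3 = 20 by have := cbS 2; lia.
have c4 : cb 4 = 70 by have := cbS 3; lia.
have c5 : cb 5 = nat_of_bin 252 by have := cbS 4; lia.
have c6 : cb 6 = nat_of_bin 924 by have := cbS 5; lia.
have c7 : cb 7 = nat_of_bin 3432 by have := cbS 6; lia.
(* The binomials not covered by the general rules collected in [rec]. *)
have bins : (('C(3, 2) = 3) * ('C(4, 2) = 6) * ('C(4, 3) = 4) * ('C(5, 2) = 10)
  * ('C(1, 2) = 0) * ('C(1, 3) = 0) * ('C(1, 4) = 0) * ('C(1, 5) = 0) * ('C(1, 6) = 0)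
  * ('C(2, 3) = 0) * ('C(2, 4) = 0) * ('C(2, 5) = 0) * ('C(3, 4) = 0))%type.
  by do !split.
pose rec := (subSS, subn0, bin0, bin1, binn, bin0n, bins).
have w1' : w 1 = nat_of_bin 1 := w1.
have w2 : w 2 = nat_of_bin 3.
  have e := w_cb _ (isT : 0 < 1).
  by rewrite !big_nat_recl // !big_geq // !rec /= in e; lia.
have w3 : w 3 = nat_of_bin 13.
  have e := w_cb _ (isT : 0 < 2).
  by rewrite !big_nat_recl // !big_geq // !rec /= in e; lia.
have w4 : w 4 = nat_of_bin 69.
  have e := w_cb _ (isT : 0 < 3).
  by rewrite !big_nat_recl // !big_geq // !rec /= in e; lia.
have w5 : w 5 = nat_of_bin 401.
  have e := w_cb _ (isT : 0 < 4).
  by rewrite !big_nat_recl // !big_geq // !rec /= in e; lia.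
have w6 : w 6 = nat_of_bin 2433.
  have e := w_cb _ (isT : 0 < 5).
  by rewrite !big_nat_recl // !big_geq // !rec /= in e; lia.
have w7 : w 7 = nat_of_bin 15121.
  have e := w_cb _ (isT : 0 < 6).
  by rewrite !big_nat_recl // !big_geq // !rec /= in e; lia.
have w8 : w 8 = nat_of_bin 95441.
  have e := w_cb _ (isT : 0 < 7).
  by rewrite !big_nat_recl // !big_geq // !rec /= in e; lia.
by rewrite [LHS]/= w1' w2 w3 w4 w5 w6 w7 w8.
Qed.

Theorem theorem5 :
  [/\ forall n : nat, 0 < n ->
        w n = \sum_(0 <= d < n) 2 ^ d * e n d
              + \sum_(3 <= j < n.+1) \sum_(0 <= d < (j - 3).+1) 2 ^ d * g j d,
      [seq w n | n <- iota 1 8] =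
        [seq nat_of_bin k
           | k <- [:: 1; 3; 13; 69; 401; 2433; 15121; 95441]%num]
    & (let x := fpsX rat in
       let s := fps_sqrt (1 - 8%:R * x + 8%:R * x ^+ 2) in
       W = (x + x * s) / (2%:R * (1 - x) * s))%R ].
Proof. by split; [exact: w_sum | exact: w_values | exact: W_sqrt]. Qed.
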